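(* Assume (A1), (A2) and (A3). Then for every bounded measurable $f:\mathsf X\to\mathbb R$, $$\lim_{n\to\infty}\mathbb E[f(X_n)]=\int_{\mathsf X}f(x)\pi_{\theta_\star}(x)\lambda(dx)\quad\text{and}\quad \frac1n\sum_{k=1}^nf(X_k)\xrightarrow[n\to\infty]{\text{a.s.}}\int_{\mathsf X}f(x)\pi_{\theta_\star}(x)\lambda(dx),$$ where $\pi_{\theta_\star}(x)=\frac1d\sum_{i=1}^d\frac{\pi(x)}{\theta_\star(i)}\mathbf 1_{\mathsf X_i}(x)$.
   Context: Setting: $(\mathsf X,\mathcal X)$ Polish space with Borel $\sigma$-algebra and $\sigma$-finite reference measure $\lambda$; $\pi$ a probability density w.r.t. $\lambda$; $d\ge2$; $\mathsf X_1,\dots,\mathsf X_d$ a measurable partition of $\mathsf X$; $I(x)=i$ iff $x\in\mathsf X_i$; $\theta_\star(i)=\int_{\mathsf X_i}\pi\,d\lambda$; $\Theta=\{\theta\in(0,1)^d:\sum_i\theta(i)=1\}$; $\pi_\theta(x)=\big(\sum_{i}\theta_\star(i)/\theta(i)\big)^{-1}\sum_{i}\frac{\pi(x)}{\theta(i)}\mathbf 1_{\mathsf X_i}(x)$. (A1): $0<\inf\pi\le\sup\pi<\infty$ and $\min_i\theta_\star(i)>0$. (A2): $P_\theta$ is the Metropolis–Hastings kernel with target $\pi_\theta\,d\lambda$ and symmetric proposal density $q$ w.r.t. $\lambda$ with $\inf_{\mathsf X^2}q>0$. (A3): $\{\gamma_n\}_{n\ge1}$ deterministic, $[0,1)$-valued,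 non-increasing, $\gamma_n\to0$, $\sum\gamma_n=\infty$, $\sum\gamma_n^2<\infty$. Linearized Wang–Landau algorithm: $X_0\in\mathsf X$, $\theta_0\in\Theta$; $X_{n+1}\sim P_{\theta_n}(X_n,\cdot)$ conditionally on $\mathcal F_n=\sigma(\theta_0,X_0,\dots,X_n)$; $\theta_{n+1}=\theta_n+\gamma_{n+1}H(X_{n+1},\theta_n)$ with $H_i(x,\theta)=\theta(i)(\mathbf 1_{\mathsf X_i}(x)-\theta(I(x)))$. *)

(* Defs.v *)
From HB Require Import structures.
From mathcomp Require Import all_boot all_order all_algebra.
From mathcomp Require Import all_classical all_reals all_analysis.
Set Implicit Arguments. Unset Strict Implicit. Unset Printing Implicit Defensive.
Import Order.TTheory GRing.Theory Num.Theory.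
Import numFieldNormedType.Exports.
Local Open Scope classical_set_scope.
Local Open Scope ring_scope.

Section WL.
Context {R : realType}.

Definition is_metric {T : Type} (dist : T -> T -> R) : Prop :=
  [/\ forall x y, 0 <= dist x y,
      forall x y, dist x y = 0 <-> x = y,
      forall x y, dist x y = dist y x &
      forall x y z, dist x z <= dist x y + dist y z].

Definition metric_open {T : Type} (dist : T -> T -> R) (A : set T) : Prop :=
  forall x, A x -> exists2 r : R, 0 < r & forall y, dist x y < r -> A y.

Definition metric_complete {T : Type} (dist : T -> T -> R) : Prop :=
  forall u : nat -> T,
    (forall e : R, 0 < e -> exists N, forall m n, (N <= m)%N -> (N <= n)%N ->
        dist (u m) (u n) < e) ->
    exists l, forall e : R, 0 < e -> exists N, forall n, (N <= n)%N -> dist (u n) l < e.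

Definition metric_separable {T : Type} (dist : T -> T -> R) : Prop :=
  exists D : nat -> T, forall x (e : R), 0 < e -> exists n, dist x (D n) < e.

Definition polish_borel {d} (X : measurableType d) : Prop :=
  exists dist : X -> X -> R,
    [/\ is_metric dist, metric_complete dist, metric_separable dist &
        forall A : set X, measurable A <-> <<s [set B | metric_open dist B] >> A].

Context {d : nat} {dX : measure_display} {X : measurableType dX}.
Variables (lam : {measure set X -> \bar R}) (pi : X -> R) (I : X -> 'I_d).

Definition part (i : 'I_d) : set X := I @^-1` [set i].

Definition theta_star (i : 'I_d) : R := fine (\int[lam]_(x in part i) (pi x)%:E)%E.

Definition in_Theta (th : 'I_d -> R) : Prop :=
  (forall i, 0 < th i < 1) /\ \sum_i th i = 1.

Definition pi_theta (th : 'I_d -> R) (x : X) : R :=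
  (\sum_i theta_star i / th i)^-1 * \sum_i (pi x / th i * \1_(part i) x).

Definition mh_accept (q : X -> X -> R) (th : 'I_d -> R) (x y : X) : R :=
  q x y * Num.min 1 (pi_theta th y / pi_theta th x).

Definition mh_kernel (q : X -> X -> R) (th : 'I_d -> R) (x : X) (A : set X) : \bar R :=
  (\int[lam]_(y in A) (mh_accept q th x y)%:E +
   (\1_A x)%:E * (1 - \int[lam]_y (mh_accept q th x y)%:E))%E.

(** Mean field of linearized Wang--Landau: H_i(x,theta) = theta(i)(1_{X_i}(x) - theta(I(x))) *)
Definition H_wl (x : X) (th : 'I_d -> R) (i : 'I_d) : R :=
  th i * (\1_(part i) x - th (I x)).

End WL.

(* Main.v *)
(* The density of P_theta with respect to lambda dominates rho pi_theta with one
   rho > 0 for all theta in Theta, so R_theta = P_theta - rho pi_theta has norm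
   1 - rho, and the fixed point F_theta = f_theta + R_theta F_theta solves the
   Poisson equation F - P F = f - pi_theta(f). It depends on theta in a
   Lipschitz way for the relative distance, for which a step of the algorithm
   has size gamma_(n+1). Hence sum a_k (f(X_(k+1)) - pi_(theta_k)(f)) splits into
   a martingale, a telescoping part and a summable remainder, and converges a.s.
   With a = gamma this controls V(theta) = - sum theta_star(i) ln theta(i), whose
   increments are affine in the indicators up to O(gamma^2) with drift
   - (sum theta_star^2/theta - 1) / (sum theta_star/theta) <= 0: V converges, so
   theta_n stays away from the boundary and, as sum gamma = +oo, tends to
   theta_star. With a_k = 1/k Kronecker's lemma gives the law of large numbers.
   For the means, E f(X_n) is expanded as sum_j rho (1 - rho)^j E pi_theta(f)
   plus a remainder, by iterating P = rho pi + R along the trajectory. *)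
Require Import Defs.
From HB Require Import structures.
From mathcomp Require Import all_boot all_order all_algebra.
From mathcomp Require Import all_classical all_reals all_analysis.
From mathcomp Require Import measurable_realfun ring lra.
Set Implicit Arguments. Unset Strict Implicit. Unset Printing Implicit Defensive.
Import Order.TTheory GRing.Theory Num.Theory.
Import numFieldNormedType.Exports.
Local Open Scope classical_set_scope.
Local Open Scope ring_scope.

(** * Bounded measurable functions *)

Section integration.
Context {R : realType}.

(** No conditional expectation is formed. The law of X_(n+1) given the past is an identity on
    products of a past event with a set of states; a functional monotone class argument extends it
    to bounded measurable functions of the past and of X_(n+1), and the increments are then
    orthogonal to every bounded function of the past. With square-summable coefficients this
    orthogonality gives a.s. convergence through a maximal inequality for stopped partial sums.
    Since [pi] has mass 1 and is bounded below, lambda is finite, so every bounded measurable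
    function is integrable. The constant rho is [cq * m / C]: the proposal is at least [cq], and
    every density pi_theta is at most [C / m]. The Poisson equation controls weighted sums along the
    trajectory but not the mean at a single time. The expansion of E f(X_n) has a remainder of order
    (1 - rho)^j for large n; the depth j is chosen before n, so the Lipschitz constants, which
    depend on the depth, are harmless. *)

Lemma cvgn_cauchy (u : nat -> R) :
  (forall e, 0 < e -> exists N, forall n, (N <= n)%N -> `|u n - u N| <= e) ->
  cvgn u.
Proof.
move=> h; apply/cauchy_cvgP/cauchy_exP => e e0.
have [N hN] := h (e / 2) (divr_gt0 e0 (ltr0Sn _ _)).
exists (u N); exists N => // n /= Nn; rewrite /ball/= distrC.
by rewrite (le_lt_trans (hN _ Nn))// gtr_pMr// invf_lt1// ltr1n.
Qed.

Lemma series_shift (u : nat -> R) m i :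
  series u (m + i)%N - series u m = \sum_(k < i) u (m + k)%N.
Proof.
rewrite sub_series_geq ?leq_addr// -{1}[m]add0n big_addn addnC addnK big_mkord.
by apply: eq_bigr => k _; rewrite addnC.
Qed.

Lemma integrable_dominated d (T : measurableType d)
    (mu : {measure set T -> \bar R}) (f g : T -> R) :
  measurable_fun setT f -> mu.-integrable setT (EFin \o g) ->
  (forall x, `|f x| <= g x) -> mu.-integrable setT (EFin \o f).
Proof.
move=> mf ig fg; apply: le_integrable ig => //.
  exact/measurable_EFinP.
by move=> x _ /=; rewrite lee_fin (le_trans (fg x))// ler_norm.
Qed.

Lemma integrable_bounded d (T : measurableType d)
    (mu : {finite_measure set T -> \bar R}) (f : T -> R) M :
  measurable_fun setT f -> (forall x, `|f x| <= M) ->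
  mu.-integrable setT (EFin \o f).
Proof.
move=> mf fM; apply: (@integrable_dominated _ _ mu f (cst M)) => //.
exact: finite_measure_integrable_cst.
Qed.

Lemma ler_norm_Rintegral d (T : measurableType d)
    (mu : {measure set T -> \bar R}) (f g : T -> R) :
  measurable_fun setT f -> mu.-integrable setT (EFin \o g) ->
  (forall x, `|f x| <= g x) -> `|\int[mu]_x f x| <= \int[mu]_x g x.
Proof.
move=> mf ig fg; have fi := integrable_dominated mf ig fg.
rewrite (le_trans (le_normr_Rintegral measurableT fi))//.
by apply: le_Rintegral => //; exact: integrable_norm.
Qed.

Lemma cvg_Rintegral_ae d (T : measurableType d)
    (mu : {measure set T -> \bar R}) (f_ : nat -> T -> R) (f g : T -> R) :
  (forall n, measurable_fun setT (f_ n)) -> measurable_fun setT f ->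
  {ae mu, forall x, f_ ^~ x @ \oo --> f x} ->
  mu.-integrable setT (EFin \o g) ->
  (forall n x, `|f_ n x| <= g x) ->
  (fun n => \int[mu]_x f_ n x) @ \oo --> \int[mu]_x f x.
Proof.
move=> mf_ mf ff ig fg.
have mf_' n : measurable_fun setT (EFin \o f_ n) by exact/measurable_EFinP.
have mf' : measurable_fun setT (EFin \o f) by exact/measurable_EFinP.
have [||i1 _ cv] := dominated_convergence measurableT mf_' mf' _ ig.
- by apply: filterS ff => x ff _; apply: cvg_EFin => //; exact: nearW.
- by apply: nearW => x n _ /=; rewrite lee_fin.
apply: fine_cvg; rewrite /Rintegral fineK; last exact: integrable_fin_num.
exact: cv.
Qed.

Lemma cvg_Rintegral d (T : measurableType d)
    (mu : {measure set T -> \bar R}) (f_ : nat -> T -> R) (f g : T -> R) :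
  (forall n, measurable_fun setT (f_ n)) ->
  (forall x, f_ ^~ x @ \oo --> f x) ->
  mu.-integrable setT (EFin \o g) ->
  (forall n x, `|f_ n x| <= g x) ->
  (fun n => \int[mu]_x f_ n x) @ \oo --> \int[mu]_x f x.
Proof.
move=> mf_ ff; apply: cvg_Rintegral_ae => //; last exact: nearW.
by apply: (measurable_fun_cvg mf_) => x _; exact: ff.
Qed.

(** Tonelli gives measurability for nonnegative integrands, so the positive and negative parts are
    treated separately; subtraction and [fine] then preserve measurability. *)
Lemma measurable_Rintegral d d' (T : measurableType d) (Y : measurableType d')
    (mu : {sigma_finite_measure set Y -> \bar R}) (h : T * Y -> R) :
  measurable_fun setT h ->
  measurable_fun setT (fun t => \int[mu]_y h (t, y)).
Proof.
move=> mh; apply: measurableT_comp => //.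
under eq_fun do rewrite integralE.
have me : measurable_fun setT (EFin \o h) by exact/measurable_EFinP.
apply: emeasurable_funB.
- have : measurable_fun setT (fubini_F mu (EFin \o h)^\+%E).
    apply: measurable_fun_fubini_tonelli_F; first exact: measurable_funepos.
    by move=> z; exact: funepos_ge0.
  congr measurable_fun; apply/funext => t; apply: eq_integral => y _.
  by rewrite !funeposE.
- have : measurable_fun setT (fubini_F mu (EFin \o h)^\-%E).
    apply: measurable_fun_fubini_tonelli_F; first exact: measurable_funeneg.
    by move=> z; exact: funeneg_ge0.
  congr measurable_fun; apply/funext => t; apply: eq_integral => y _.
  by rewrite !funenegE.
Qed.

Lemma measurable_inv_pos d (T : measurableType d) (f : T -> R) :
  measurable_fun setT f -> (forall t, 0 < f t) ->
  measurable_fun setT (fun t => (f t)^-1).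
Proof.
move=> mf f0; apply: (eq_measurable_fun (fun t => powR (f t) (-1))).
  by move=> t _; rewrite powR_inv1// ltW.
exact: (measurableT_comp (measurable_powR (-1)) mf).
Qed.

Definition bounded_measurable d (T : measurableType d) (f : T -> R) :=
  measurable_fun setT f /\ exists M, forall x, `|f x| <= M.

Lemma bounded_measurable_indic d (T : measurableType d) (A : set T) :
  measurable A -> bounded_measurable (\1_A : T -> R).
Proof.
move=> mA; split; first exact: measurable_indic.
by exists 1 => x; rewrite indicE; case: (_ \in _); rewrite ?normr1 ?normr0.
Qed.

Lemma bounded_measurableZ d (T : measurableType d) (c : R) (f : T -> R) :
  bounded_measurable f -> bounded_measurable (fun x => c * f x).
Proof.
move=> [mf [M fM]]; split; first exact: measurable_funM.
by exists (`|c| * M) => x; rewrite normrM ler_wpM2l.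
Qed.

Lemma bounded_measurableD d (T : measurableType d) (f g : T -> R) :
  bounded_measurable f -> bounded_measurable g ->
  bounded_measurable (fun x => f x + g x).
Proof.
move=> [mf [M fM]] [mg [N gN]]; split; first exact: measurable_funD.
by exists (M + N) => x; rewrite (le_trans (ler_normD _ _))// lerD.
Qed.

Lemma bounded_measurable_sum d (T : measurableType d) (h : nat -> T -> R) n :
  (forall i, bounded_measurable (h i)) ->
  bounded_measurable (fun x => \sum_(i < n) h i x).
Proof.
move=> bh; elim: n => [|n IH].
  split; first by under eq_fun do rewrite big_ord0; exact: measurable_cst.
  by exists 0 => x; rewrite big_ord0 normr0.
rewrite (_ : (fun x => _) = (fun x => \sum_(i < n) h i x + h n x)).
  exact: bounded_measurableD.
by apply/funext => x; rewrite big_ord_recr.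
Qed.

(** * Functional monotone class theorem on a product space *)

Section functional_monotone_class.
Context d1 d2 (T1 : measurableType d1) (T2 : measurableType d2).
Notation T := (T1 * T2)%type.
Variable L : (T -> R) -> R.
Hypothesis LD : forall f g, bounded_measurable f -> bounded_measurable g ->
  L (fun x => f x + g x) = L f + L g.
Hypothesis LZ : forall c f, bounded_measurable f ->
  L (fun x => c * f x) = c * L f.
Hypothesis Lcvg : forall (f_ : nat -> T -> R) f M,
  (forall n, measurable_fun setT (f_ n)) -> (forall n x, `|f_ n x| <= M) ->
  (forall x, f_ ^~ x @ \oo --> f x) -> (forall n, L (f_ n) = 0) -> L f = 0.
Hypothesis Lrect : forall A B, measurable A -> measurable B ->
  L (\1_(A `*` B)) = 0.

(** Dynkin's argument: rectangles are stable under intersection and generate the product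
    sigma-algebra. The sets on which [L] vanishes form a lambda-system, by linearity for proper
    differences and by [Lcvg] for increasing unions. *)
Let L_indic (A : set T) : measurable A -> L (\1_A) = 0.
Proof.
suff : measurable `<=` [set A : set T | measurable A /\ L (\1_A) = 0].
  by move=> h /h[].
rewrite {1}measurable_prod_measurableType.
set C := [set A1 `*` A2 | A1 in measurable & A2 in measurable].
apply: lambda_system_subset => //.
- move=> _ _ [X1 mX1 [X2 mX2 <-]] [Y1 mY1 [Y2 mY2 <-]].
  exists (X1 `&` Y1); first exact: measurableI.
  by exists (X2 `&` Y2); [exact: measurableI|rewrite setXI].
- split => //.
  + by split => //; rewrite -setXTT; exact: Lrect.
  + move=> U V VU [mU LU] [mV LV]; split; first exact: measurableD.
    have -> : \1_(U `\` V) = (fun x => \1_U x + -1 * \1_V x) :> (T -> R).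
      apply/funext => x; rewrite !indicE in_setD.
      case: (boolP (x \in V)) => xV /=; last by rewrite andbT mulr0 addr0.
      by rewrite andbF (mem_set (VU _ (set_mem xV))) /= mulr1 subrr.
    rewrite LD ?LZ ?LU ?LV ?mulr0 ?addr0 //; try exact: bounded_measurable_indic.
    exact/bounded_measurableZ/bounded_measurable_indic.
  + move=> F ndF LF; have mF i : measurable (F i) by have [] := LF i.
    split; first exact: bigcupT_measurable.
    apply: (@Lcvg (fun n => \1_(F n)) _ 1).
    * by move=> n; exact: measurable_indic.
    * by move=> n x; rewrite indicE; case: (_ \in _); rewrite ?normr1 ?normr0.
    * move=> x; rewrite [X in _ --> X]indicE.
      have [[n _ Fnx]|nF] := pselect ((\bigcup_i F i) x).
        rewrite mem_set; last by exists n.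
        apply: cvg_near_cst; exists n => // m /= nm.
        by rewrite indicE mem_set//; move/subsetPset: (ndF _ _ nm); exact.
      rewrite memNset//; apply: cvg_near_cst; apply: nearW => m.
      by rewrite indicE memNset// => Fmx; apply: nF; exists m.
    * by move=> n; have [] := LF n.
- move=> _ [A1 mA1 [A2 mA2 <-]]; split; first exact: measurableX.
  exact: Lrect.
Qed.

Let L_sum (h : nat -> T -> R) n : (forall i, bounded_measurable (h i)) ->
  (forall i, L (h i) = 0) -> L (fun x => \sum_(i < n) h i x) = 0.
Proof.
move=> bh Lh; elim: n => [|n IH].
  have L0 : L (fun x => 0 * h 0%N x) = 0 by rewrite LZ ?mul0r.
  rewrite (_ : (fun x => _) = (fun x => 0 * h 0%N x))//.
  by apply/funext => x; rewrite big_ord0 mul0r.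
rewrite (_ : (fun x => _) = (fun x => \sum_(i < n) h i x + h n x)); last first.
  by apply/funext => x; rewrite big_ord_recr.
by rewrite LD ?IH ?Lh ?addr0//; exact: bounded_measurable_sum.
Qed.

Import HBNNSimple.

(** Simple functions increase to [f], hence stay below [M] as [Lcvg] requires, and each is a finite
    combination of indicators. *)
Let L_ge0 (f : T -> R) M : measurable_fun setT f -> (forall x, 0 <= f x <= M) ->
  L f = 0.
Proof.
move=> mf f0M.
have me : measurable_fun setT (EFin \o f) by exact/measurable_EFinP.
pose g := nnsfun_approx measurableT me.
have fM x : f x <= M by case/andP: (f0M x).
have f0 x : (0 <= (EFin \o f) x)%E by rewrite lee_fin; case/andP: (f0M x).
have cg x : (g ^~ x) @ \oo --> f x.
  have := @cvg_nnsfun_approx _ _ _ _ measurableT _ me (fun x _ => f0 x) x Logic.I.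
  by move/fine_cvg.
have ndg x : nondecreasing_seq (g ^~ x).
  by move=> m n mn; apply/lefP/nd_nnsfun_approx.
have gM n x : g n x <= M.
  rewrite (le_trans _ (fM x))// -(cvg_lim _ (cg x))//.
  by apply: nondecreasing_cvgn_le => //; apply/cvg_ex; exists (f x).
apply: (@Lcvg (fun n => g n) _ M) => //.
- by move=> n x; rewrite ger0_norm ?fun_ge0//.
move=> n; pose s := fset_set (g n @` setT).
pose t : seq R := finmap.enum_fset s.
pose h (i : nat) (x : T) : R := t`_i * \1_(g n @^-1` [set t`_i]) x.
have -> : (g n : T -> R) = (fun x => \sum_(i < size t) h i x).
  exact/funext/fimfunEord.
apply: L_sum => i; first exact/bounded_measurableZ/bounded_measurable_indic.
rewrite LZ ?L_indic ?mulr0//; exact: bounded_measurable_indic.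
Qed.

Lemma functional_monotone_class f : bounded_measurable f -> L f = 0.
Proof.
move=> [mf [M fM]].
have M0 : 0 <= M := le_trans (normr_ge0 _) (fM point).
have mfM : measurable_fun setT (fun x => f x + M) by exact: measurable_funD.
have b x : 0 <= f x + M <= M + M.
  by have := fM x; rewrite ler_norml => /andP[]; lra.
(* Shifting by the bound reduces to the nonnegative case, and linearity removes the constant. *)
have -> : f = (fun x => (f x + M) + -1 * (M * \1_setT x)).
  by apply/funext => x; rewrite indicE in_setT/=; lra.
have bT : bounded_measurable (\1_setT : T -> R).
  exact: bounded_measurable_indic.
rewrite LD ?LZ ?(L_ge0 mfM b) ?L_indic ?mulr0 ?addr0//.
- exact: bounded_measurableZ.
- by split=> //; exists (M + M) => x; rewrite ger0_norm; have /andP[] := b x.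
- exact/bounded_measurableZ/bounded_measurableZ.
Qed.

End functional_monotone_class.
End integration.

(** * Uniform estimates for the Metropolis kernel *)

(** The bound is free of [r]: truncation at 1 turns a relative error on an arbitrarily large
    acceptance ratio into an absolute one. *)
Lemma ler_dist_min1 (R : realFieldType) (r t : R) : 0 <= r -> 0 <= t ->
  `|Num.min 1 (r * t) - Num.min 1 r| <= `|t - 1|.
Proof.
move=> r0 t0; have [rt|rt] := leP 1 (r * t); have [r1|r1] := leP 1 r.
- by rewrite subrr normr0.
- have t1 : 1 <= t by nra.
  by rewrite !ger0_norm ?subr_ge0// ?(ltW r1)//; nra.
- have t1 : t <= 1 by nra.
  by rewrite !ler0_norm ?subr_le0// ?(ltW rt)//; nra.
- rewrite (_ : r * t - r = r * (t - 1)); last by ring.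
  by rewrite normrM ger0_norm//; have := normr_ge0 (t - 1); nra.
Qed.

(** The numerator [u - v] is at most [2 * g], and [g1] keeps the denominator above [1 - g1]. This is
    the origin of the constant [K] used below. *)
Lemma ler_dist_ratio (R : realFieldType) (g g1 u v : R) :
  0 <= g <= g1 -> g1 < 1 -> `|u - 1| <= g -> `|v - 1| <= g ->
  `|u / v - 1| <= 2 / (1 - g1) * g.
Proof.
move=> /andP[g0 gg1] g11 + +; rewrite {1}ler_norml => /andP[u1 u2].
rewrite {1}ler_norml => /andP[v1 v2].
have v0 : 0 < v by lra.
have k0 : 0 < 1 - g1 by lra.
have -> : u / v - 1 = (u - v) / v by field; lra.
rewrite normrM (@ger0_norm _ v^-1) ?invr_ge0 ?(ltW v0)// ler_pdivrMr//.
have h : 2 / (1 - g1) * g * (1 - g1) = 2 * g by field; lra.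
have h0 : 0 <= 2 / (1 - g1) * g by rewrite mulr_ge0// divr_ge0// ltW.
have : 2 * g <= 2 / (1 - g1) * g * v by rewrite -h ler_wpM2l//; lra.
by move=> h2; rewrite ler_norml; apply/andP; split; lra.
Qed.

(** A second index carries positive weight, which keeps each coordinate strictly below 1. *)
Lemma in_Theta_pos (R : realType) (d : nat) (t : 'I_d -> R) : (2 <= d)%N ->
  (forall i, 0 < t i) -> \sum_i t i = 1 -> in_Theta t.
Proof.
move=> d2 pos sum1; split=> // i; rewrite pos/= -sum1.
have [j ji] : exists j : 'I_d, j != i.
  pose k : nat := if (i : nat) == 0%N then 1%N else 0%N.
  have kd : (k < d)%N by rewrite /k; case: ifP => // _; exact: ltnW.
  exists (Ordinal kd); apply/negP => /eqP/(congr1 val)/=; rewrite /k.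
  by case: ifPn => [/eqP ->//|/[swap] <-].
rewrite (bigD1 i)//= ltrDl (bigD1 j)//= ltr_pwDl// sumr_ge0// => k _.
exact: ltW.
Qed.

Section target_density.
Context {R : realType} {d : nat} {dX : measure_display} {X : measurableType dX}.
Variables (lam : {finite_measure set X -> \bar R}) (pi : X -> R) (I : X -> 'I_d)
  (q : X -> X -> R).

Notation Th := ('I_d -> R).
Notation ts := (theta_star lam pi I).
Notation p := (pi_theta lam pi I).
Notation a := (mh_accept lam pi I q).

(** (A1) and (A2) with named constants, so that the minorization constant is explicit. The lower
    bound on [pi] enters through the finiteness of [lam]. *)
Record wl_setting (C m cq : R) : Prop := {
  wl_partition : forall i, measurable (part I i);
  wl_mpi : measurable_fun setT pi;
  wl_pi : forall x, 0 < pi x <= C;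
  wl_pi1 : (\int[lam]_x (pi x)%:E = 1)%E;
  wl_m0 : 0 < m;
  wl_ts : forall i, m <= ts i;
  wl_mq : measurable_fun setT (fun xy : X * X => q xy.1 xy.2);
  wl_qsym : forall x y, q x y = q y x;
  wl_q1 : forall x, (\int[lam]_y (q x y)%:E = 1)%E;
  wl_cq0 : 0 < cq;
  wl_q : forall x y, cq <= q x y }.

Definition mh_operator (th : Th) (phi : X -> R) (x : X) : R :=
  \int[lam]_y (a th x y * phi y) + phi x * (1 - \int[lam]_y a th x y).

Definition pi_operator (th : Th) (phi : X -> R) : R := \int[lam]_y (p th y * phi y).

(* A relative distance: one step of the algorithm changes each weight by a
   factor in [1 - gamma, 1 + gamma], and the kernel depends on th only through
   ratios of weights. All estimates below are therefore uniform on Theta, up to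
   its boundary, and no prior stability of the weights is needed. *)
Definition param_close (g : R) (th th' : Th) := forall i, `|th' i - th i| <= g * th i.

(** Joint measurability is tested along measurable families of parameters in Theta, so no
    sigma-algebra on [Th] has to be fixed. In the algorithm [T] is the sample space with the
    sigma-algebra of the past. *)
Definition param_measurable (F : Th -> X -> R) := forall dT (T : measurableType dT)
    (th : T -> Th), (forall i, measurable_fun setT (th ^~ i)) ->
  (forall t, in_Theta (th t)) ->
  measurable_fun setT (fun z : T * X => F (th z.1) z.2).

Variables (C m cq : R).
Hypothesis H : wl_setting C m cq.

Let C0 : 0 < C.
Proof. by have /andP[/lt_le_trans h /h] := wl_pi H point. Qed.
Let m0 := wl_m0 H.
Let cq0 := wl_cq0 H.
Let pi0 x : 0 < pi x. Proof. by have /andP[] := wl_pi H x. Qed.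
Let piC x : pi x <= C. Proof. by have /andP[] := wl_pi H x. Qed.
Let tsm := wl_ts H.
Let ts0 i : 0 < ts i. Proof. exact: lt_le_trans (tsm i). Qed.
Let q0 x y : 0 < q x y. Proof. exact: lt_le_trans (wl_q H x y). Qed.

Definition doeblin_cst : R := cq * m / C.
Notation rho := doeblin_cst.

Lemma doeblin_cst_gt0 : 0 < rho.
Proof. by rewrite /rho divr_gt0// mulr_gt0. Qed.

(** This is pi / pi_theta on stratum i. Written with ratios, it is visibly invariant under scaling
    of the weights and at least [m], by its term j = i. *)
Definition stratum_weight (th : Th) (i : 'I_d) : R := \sum_j ts j * (th i / th j).
Notation W := stratum_weight.

Lemma stratum_weight_ge th i : in_Theta th -> m <= W th i.
Proof.
move=> [th01 _]; have th0 j : 0 < th j by case/andP: (th01 j).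
rewrite /W (bigD1 i)//= divff ?gt_eqF// mulr1 (le_trans (tsm i))// lerDl.
by apply: sumr_ge0 => j _; rewrite mulr_ge0 ?divr_ge0// ltW.
Qed.

Lemma pi_thetaE th x : in_Theta th -> p th x = pi x / W th (I x).
Proof.
move=> tT; have [th01 _] := tT; have th0 j : 0 < th j by case/andP: (th01 j).
have h : \sum_i (pi x / th i * \1_(part I i) x) = pi x / th (I x).
  rewrite (bigD1 (I x))//= big1 => [|i iIx]; last first.
    by rewrite indicE memNset ?mulr0// => /= h; rewrite h eqxx in iIx.
  by rewrite addr0 indicE mem_set// mulr1.
rewrite /pi_theta h.
have -> : W th (I x) = th (I x) * \sum_i ts i / th i.
  by rewrite /W mulr_sumr; apply: eq_bigr => j _; rewrite mulrCA.
by rewrite invfM [LHS]mulrC mulrA.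
Qed.

Let W0 th i : in_Theta th -> 0 < W th i.
Proof. by move=> ?; exact: lt_le_trans (stratum_weight_ge _ _). Qed.

Lemma pi_theta_gt0 th x : in_Theta th -> 0 < p th x.
Proof. by move=> tT; rewrite pi_thetaE// divr_gt0// W0. Qed.

Lemma pi_theta_le th x : in_Theta th -> p th x <= C / m.
Proof.
move=> tT; rewrite pi_thetaE//.
rewrite ler_pM ?(ltW (pi0 _)) ?invr_ge0 ?(ltW (W0 _ _))//.
by rewrite lef_pV2 ?posrE ?W0// stratum_weight_ge.
Qed.

Lemma mh_accept_ge0 th x y : in_Theta th -> 0 <= a th x y.
Proof.
move=> tT; rewrite /mh_accept mulr_ge0 ?(ltW (q0 _ _))// le_min ler01/=.
by rewrite divr_ge0// ltW// pi_theta_gt0.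
Qed.

Lemma mh_accept_le th x y : a th x y <= q x y.
Proof. by rewrite /mh_accept ler_piMr ?(ltW (q0 _ _))// ge_min lexx. Qed.

(** Since pi_theta is at most [C / m], both 1 and the ratio [p th y / p th x] dominate
    [p th y / (C / m)]. *)
Lemma mh_accept_minorization th x y : in_Theta th -> rho * p th y <= a th x y.
Proof.
move=> tT; have px := pi_theta_gt0 x tT; have py := pi_theta_gt0 y tT.
have -> : rho * p th y = cq * (p th y / (C / m)).
  by rewrite /rho; field; rewrite !gt_eqF.
apply: ler_pM; [exact: ltW|by rewrite !divr_ge0// ltW|exact: (wl_q H)|].
have B0 : 0 < C / m by rewrite divr_gt0.
rewrite le_min ler_pdivrMr// mul1r pi_theta_le//=.
by rewrite ler_pM2l// lef_pV2 ?posrE// pi_theta_le.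
Qed.

Lemma detailed_balance th x y : in_Theta th ->
  p th x * a th x y = p th y * a th y x.
Proof.
move=> tT; have px := pi_theta_gt0 x tT; have py := pi_theta_gt0 y tT.
rewrite /mh_accept (wl_qsym H y x) !(mulrCA _ (q x y)); congr (_ * _).
rewrite !minr_pMr ?(ltW px) ?(ltW py)// !mulr1.
have E u v : 0 < v -> v * (u / v) = u :> R by move=> v0; rewrite mulrC divfK ?gt_eqF.
by rewrite !E// minC.
Qed.

Section closeness.
Variables (g g1 : R) (th th' : Th).
Hypotheses (g01 : 0 <= g <= g1) (g11 : g1 < 1).
Hypotheses (tT : in_Theta th) (tT' : in_Theta th') (ct : param_close g th th').

Let th0 i : 0 < th i. Proof. by case: tT => h _; case/andP: (h i). Qed.
Let th0' i : 0 < th' i. Proof. by case: tT' => h _; case/andP: (h i). Qed.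
Let K := 2 / (1 - g1).

Let ratio i j : `|(th' i / th' j) / (th i / th j) - 1| <= K * g.
Proof.
have -> : (th' i / th' j) / (th i / th j) = (th' i / th i) / (th' j / th j).
  by field; rewrite !gt_eqF.
have h k : `|th' k / th k - 1| <= g.
  have -> : th' k / th k - 1 = (th' k - th k) / th k by field; rewrite gt_eqF.
  rewrite normrM (@ger0_norm _ (th k)^-1) ?invr_ge0 ?(ltW (th0 _))//.
  by rewrite ler_pdivrMr//; exact: ct.
exact: ler_dist_ratio.
Qed.

(** Measuring the error against a probability density makes its integral [K * g], whatever the
    parameters; [mh_accept_close] uses [q] in the same way. *)
Lemma pi_theta_close x : `|p th x - p th' x| <= K * g * p th' x.
Proof.
rewrite !pi_thetaE//; set i := I x.
have D : `|W th' i - W th i| <= K * g * W th i.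
  rewrite /W -sumrB (le_trans (ler_norm_sum _ _ _))// mulr_sumr ler_sum// => j _.
  rewrite -mulrBr normrM (gtr0_norm (ts0 j)) mulrCA ler_pM2l//.
  have r0 : 0 < th i / th j by rewrite divr_gt0.
  have -> : th' i / th' j - th i / th j =
      ((th' i / th' j) / (th i / th j) - 1) * (th i / th j).
    by rewrite mulrBl mul1r divfK// gt_eqF.
  by rewrite normrM (gtr0_norm r0) ler_pM2r// ratio.
have w0 := W0 i tT; have w0' := W0 i tT'.
have -> : pi x / W th i - pi x / W th' i
    = (W th' i - W th i) * (pi x / W th' i / W th i).
  by field; rewrite !gt_eqF.
rewrite normrM (@ger0_norm _ (_ / _)); last first.
  by rewrite !divr_ge0// ltW.
rewrite (le_trans (ler_wpM2r _ D))//.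
  by rewrite !divr_ge0// ltW.
by rewrite le_eqVlt; apply/orP; left; apply/eqP; field; rewrite !gt_eqF.
Qed.

Lemma mh_accept_close x y : `|a th x y - a th' x y| <= K * g * q x y.
Proof.
rewrite /mh_accept -mulrBr normrM (gtr0_norm (q0 _ _)) mulrC ler_pM2r// distrC.
(* The normalizing sums cancel: the acceptance ratio sees the weights only through one ratio. *)
have E t : in_Theta t -> p t y / p t x = pi y / pi x * (t (I x) / t (I y)).
  move=> tt; have [t01 _] := tt.
  have t0 j : 0 < t j by case/andP: (t01 j).
  rewrite !pi_thetaE//.
  have WE i : W t i = t i * \sum_j (ts j / t j).
    by rewrite /W mulr_sumr; apply: eq_bigr => j _; rewrite mulrCA.
  have := W0 (I x) tt; rewrite !WE pmulr_rgt0// => s0.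
  by field; rewrite !gt_eqF.
rewrite !E//.
have -> : th' (I x) / th' (I y) = th (I x) / th (I y) *
    ((th' (I x) / th' (I y)) / (th (I x) / th (I y))).
  by field; rewrite !gt_eqF.
rewrite mulrA (le_trans (ler_dist_min1 _ _)) ?ratio//.
- by rewrite mulr_ge0// divr_ge0// ltW.
- by rewrite !divr_ge0// ltW.
Qed.

End closeness.

End target_density.

Section Rintegral_misc.
Context {R : realType} d (T : measurableType d) (mu : {measure set T -> \bar R}).

Lemma Rintegral_sum n (h : 'I_n -> T -> R) :
  (forall i, mu.-integrable setT (EFin \o h i)) ->
  \int[mu]_x (\sum_i h i x) = \sum_i \int[mu]_x h i x.
Proof.
move=> ih.
(* Additivity needs integrability of the partial sum, so the induction carries it along. *)
suff [] : mu.-integrable setT (EFin \o (fun x => \sum_i h i x)) /\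
    \int[mu]_x (\sum_i h i x) = \sum_i \int[mu]_x h i x by [].
elim: n h ih => [|n IH] h ih.
  rewrite (_ : (fun x => \sum_i h i x) = cst 0); last first.
    by apply/funext => x; rewrite big_ord0.
  split; first exact: integrable0.
  by rewrite big_ord0 /Rintegral integral0.
have [i1 e1] := IH (fun i => h (widen_ord (leqnSn n) i)) (fun i => ih _).
rewrite (_ : (fun x => \sum_i h i x) =
    (fun x => \sum_i h (widen_ord (leqnSn n) i) x + h ord_max x)); last first.
  by apply/funext => x; rewrite big_ord_recr.
split; last by rewrite RintegralD// e1 big_ord_recr.
rewrite (_ : EFin \o _ = (fun x => (\sum_i h (widen_ord (leqnSn n) i) x)%:E + (h ord_max x)%:E)%E).
  exact: (integrableD measurableT i1 (ih ord_max)).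
by apply/funext => x; rewrite /= EFinD.
Qed.

End Rintegral_misc.

(** Every section is asked to be integrable, not just almost every one, so that [fine] can be
    removed pointwise inside the outer integrals. *)
Lemma Rintegral_Fubini {R : realType} d d' (T : measurableType d)
    (Y : measurableType d') (m1 : {sigma_finite_measure set T -> \bar R})
    (m2 : {sigma_finite_measure set Y -> \bar R}) (f : T * Y -> R) :
  (m1 \x m2)%E.-integrable setT (EFin \o f) ->
  (forall x, m2.-integrable setT (fun y => (f (x, y))%:E)) ->
  (forall y, m1.-integrable setT (fun x => (f (x, y))%:E)) ->
  \int[m1]_x \int[m2]_y f (x, y) = \int[m2]_y \int[m1]_x f (x, y).
Proof.
move=> fi i2 i1; rewrite {1 3}/Rintegral.
under eq_integral do rewrite /Rintegral fineK ?integrable_fin_num//.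
under [in RHS]eq_integral do rewrite /Rintegral fineK ?integrable_fin_num//.
by rewrite (Fubini fi).
Qed.

(** * Integrals over the strata and measurability in the parameter *)

Section stratum_integrals.
Context {R : realType} {d : nat} {dX : measure_display} {X : measurableType dX}.
Variables (lam : {finite_measure set X -> \bar R}) (pi : X -> R) (I : X -> 'I_d)
  (q : X -> X -> R).

Notation Th := ('I_d -> R).
Notation ts := (theta_star lam pi I).
Notation p := (pi_theta lam pi I).
Notation a := (mh_accept lam pi I q).
Notation pi_op := (pi_operator lam pi I).
Variables (C m cq : R).
Hypothesis H : wl_setting lam pi I q C m cq.

Let ts0 i : 0 < ts i.
Proof. exact: lt_le_trans (wl_m0 H) (wl_ts H i). Qed.
Let pi0 x : 0 < pi x. Proof. by have /andP[] := wl_pi H x. Qed.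
Let piC x : pi x <= C. Proof. by have /andP[] := wl_pi H x. Qed.
Let mpi := wl_mpi H.
Let mI := wl_partition H.

Lemma integrable_target : lam.-integrable setT (EFin \o pi).
Proof.
apply: (integrable_bounded lam (M := C)) => // x.
by rewrite gtr0_norm.
Qed.

Lemma Rintegral_strata (phi : Th) :
  \int[lam]_x (pi x * phi (I x)) = \sum_i phi i * ts i.
Proof.
have mpI i : measurable_fun setT (fun x => pi x * \1_(part I i) x).
  by apply: measurable_funM => //; exact: measurable_indic.
have ipI i : lam.-integrable setT (EFin \o (fun x => pi x * \1_(part I i) x)).
  apply: (integrable_dominated (g := pi)) => //; first exact: integrable_target.
  move=> x; rewrite normrM (gtr0_norm (pi0 x)) ler_piMr ?(ltW (pi0 x))//.
  by rewrite indicE; case: (_ \in _); rewrite ?normr1 ?normr0.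
have -> : (fun x => pi x * phi (I x))
    = (fun x => \sum_i phi i * (pi x * \1_(part I i) x)).
  apply/funext => x; rewrite (bigD1 (I x))//= big1 => [|i iIx]; last first.
    by rewrite indicE memNset ?mulr0// => /= h; rewrite h eqxx in iIx.
  by rewrite addr0 indicE mem_set// mulr1 mulrC.
rewrite Rintegral_sum => [|i]; last first.
  exact: (integrableZl measurableT (phi i) (ipI i)).
apply: eq_bigr => i _; rewrite RintegralZl//; congr (_ * _).
rewrite /theta_star -[RHS]/(\int[lam]_(x in part I i) pi x) [RHS]Rintegral_mkcond.
apply: eq_Rintegral => x _; rewrite /patch indicE.
by case: ifPn => _; rewrite ?mulr1 ?mulr0.
Qed.

Lemma theta_star_sum : \sum_i ts i = 1.
Proof.
under eq_bigr do rewrite -[ts _]mul1r.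
rewrite -(Rintegral_strata (fun=> 1)) /Rintegral.
by under eq_integral do rewrite mulr1; rewrite (wl_pi1 H).
Qed.

Lemma pi_op_strata th (phi : Th) : in_Theta th ->
  pi_op th (fun x => phi (I x)) =
  (\sum_i ts i / th i)^-1 * \sum_i (ts i / th i * phi i).
Proof.
move=> tT; have [th01 _] := tT.
have th0 j : 0 < th j by case/andP: (th01 j).
rewrite /pi_operator.
have WE i : stratum_weight lam pi I th i = th i * \sum_j ts j / th j.
  by rewrite /stratum_weight mulr_sumr; apply: eq_bigr => j _; rewrite mulrCA.
under eq_Rintegral do rewrite (pi_thetaE lam pi)// WE -mulrA.
rewrite (Rintegral_strata (fun i => (th i * \sum_j ts j / th j)^-1 * phi i)).
rewrite mulr_sumr; apply: eq_bigr => i _; rewrite invfM.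
set z := (\sum_j _)^-1; set t := (th i)^-1; ring.
Qed.

Let Z0 th : in_Theta th -> 0 < \sum_i ts i / th i.
Proof.
move=> [th01 _]; have th0 j : 0 < th j by case/andP: (th01 j).
rewrite (bigD1 (I point))//= ltr_pwDl ?divr_gt0//.
by apply: sumr_ge0 => j _; rewrite divr_ge0// ltW.
Qed.

Lemma pi_op1 th : in_Theta th -> \int[lam]_x p th x = 1.
Proof.
move=> tT; transitivity (pi_op th (fun=> 1)).
  by apply: eq_Rintegral => x _; rewrite mulr1.
rewrite (pi_op_strata (fun=> 1))//.
by under [X in _ * X]eq_bigr do rewrite mulr1; rewrite mulVf// gt_eqF// Z0.
Qed.

Lemma param_measurable_stratum (phi : Th -> Th) :
  (forall i dT (T : measurableType dT) (th : T -> Th),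
    (forall i, measurable_fun setT (th ^~ i)) -> (forall t, in_Theta (th t)) ->
    measurable_fun setT (fun t => phi (th t) i)) ->
  param_measurable (fun th x => phi th (I x)).
Proof.
move=> mphi dT T th mth tT.
rewrite (_ : (fun z => _) =
  (fun z : T * X => \sum_i phi (th z.1) i * \1_(part I i) z.2)).
  apply: measurable_sum => i; apply: measurable_funM.
    exact: (measurableT_comp (mphi i _ _ th mth tT)).
  exact: (measurableT_comp (measurable_indic (mI i)) measurable_snd).
apply/funext => z; rewrite (bigD1 (I z.2))//= big1 => [|i iIx]; last first.
  by rewrite indicE memNset ?mulr0// => /= h; rewrite h eqxx in iIx.
by rewrite addr0 indicE mem_set// mulr1.
Qed.

Lemma param_measurable_pi_theta : param_measurable p.
Proof.
move=> dT T th mth tT; have th0 t j : 0 < th t j by case: (tT t) => h _; case/andP: (h j).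
rewrite /pi_theta; apply: measurable_funM.
  apply: (measurableT_comp (f := fun t => (\sum_i ts i / th t i)^-1)) => //.
  apply: measurable_inv_pos => [|t]; last exact: Z0.
  by apply: measurable_sum => i; apply: measurable_funM => //; exact: measurable_inv_pos.
apply: measurable_sum => i; apply: measurable_funM; last first.
  exact: (measurableT_comp (measurable_indic (mI i)) measurable_snd).
apply: measurable_funM; first exact: (measurableT_comp mpi).
apply: (measurableT_comp (f := fun t => (th t i)^-1)) => //.
exact: measurable_inv_pos.
Qed.

Lemma measurable_mh_accept dT (T : measurableType dT) (th : T -> Th) :
  (forall i, measurable_fun setT (th ^~ i)) -> (forall t, in_Theta (th t)) ->
  measurable_fun setT (fun z : T * X * X => a (th z.1.1) z.1.2 z.2).
Proof.
move=> mth tT.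
have mth1 i : measurable_fun setT (fun z : T * X => th z.1 i).
  exact: (measurableT_comp (mth i)).
have mp2 : measurable_fun setT (fun z : T * X * X => p (th z.1.1) z.2).
  exact: (param_measurable_pi_theta (th := fun z : T * X => th z.1)).
have mp1 : measurable_fun setT (fun z : T * X * X => p (th z.1.1) z.1.2).
  exact: (measurableT_comp (param_measurable_pi_theta mth tT)).
rewrite /mh_accept; apply: measurable_funM.
  apply: (measurableT_comp (wl_mq H) (g := fun z : T * X * X => (z.1.2, z.2))).
  apply: measurable_fun_pair => //.
  exact: (measurableT_comp measurable_snd).
apply: measurable_minr => //; apply: measurable_funM => //.
by apply: measurable_inv_pos => // z; exact: (pi_theta_gt0 H).
Qed.

End stratum_integrals.

(** * The operators P_theta, pi_theta and their residual on bounded functions *)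

Section operators.
Context {R : realType} {d : nat} {dX : measure_display} {X : measurableType dX}.
Variables (lam : {finite_measure set X -> \bar R}) (pi : X -> R) (I : X -> 'I_d)
  (q : X -> X -> R).

Notation Th := ('I_d -> R).
Notation p := (pi_theta lam pi I).
Notation a := (mh_accept lam pi I q).
Notation pi_op := (pi_operator lam pi I).
Notation mh_op := (mh_operator lam pi I q).
Variables (C m cq : R).
Notation rho := (doeblin_cst C m cq).
Hypothesis H : wl_setting lam pi I q C m cq.

Let q0 x y : 0 < q x y.
Proof. exact: lt_le_trans (wl_cq0 H) (wl_q H x y). Qed.
Let C0 : 0 < C. Proof. by have /andP[/lt_le_trans h /h] := wl_pi H point. Qed.
Let m0 := wl_m0 H.
Let rho0 : 0 < rho := doeblin_cst_gt0 H.

Lemma param_measurable_fix (F : Th -> X -> R) (th : Th) : param_measurable F -> in_Theta th ->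
  measurable_fun setT (F th : X -> R).
Proof.
move=> mF tT; have := mF _ X (fun=> th) (fun=> measurable_cst _) (fun=> tT).
by move=> h; exact: (measurableT_comp h (pair1_measurable point)).
Qed.

Lemma measurable_proposal x : measurable_fun setT (q x).
Proof. exact: (measurableT_comp (wl_mq H) (pair1_measurable x)). Qed.

Lemma integrable_proposal x : lam.-integrable setT (EFin \o q x).
Proof.
apply/integrableP; split; first exact/measurable_EFinP/measurable_proposal.
under eq_integral do rewrite /= gtr0_norm//.
by rewrite (wl_q1 H) ltry.
Qed.

Lemma Rintegral_proposal x : \int[lam]_y q x y = 1.
Proof. by rewrite /Rintegral (wl_q1 H). Qed.

Let integrable_le_proposal x (h : X -> R) K : measurable_fun setT h ->
  (forall y, `|h y| <= K * q x y) -> lam.-integrable setT (EFin \o h).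
Proof.
move=> mh hK; apply: (@integrable_dominated _ _ _ _ h (fun y => K * q x y)) => //.
exact: (integrableZl measurableT K (integrable_proposal x)).
Qed.

Let Rintegral_le_proposal x (h : X -> R) K : measurable_fun setT h ->
  (forall y, `|h y| <= K * q x y) -> `|\int[lam]_y h y| <= K.
Proof.
move=> mh hK.
rewrite (le_trans (@ler_norm_Rintegral _ _ _ _ h (fun y => K * q x y) _ _ _))//.
  exact: (integrableZl measurableT K (integrable_proposal x)).
by rewrite RintegralZl ?Rintegral_proposal ?mulr1//; exact: integrable_proposal.
Qed.

Lemma measurable_accept2 (th : Th) : in_Theta th ->
  measurable_fun setT (fun z : X * X => a th z.1 z.2).
Proof.
move=> tT.
have h := measurable_mh_accept H (fun=> measurable_cst _) (fun _ : X => tT).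
apply: (measurableT_comp h (g := fun z : X * X => ((z.1, z.1), z.2))).
by do ! apply: measurable_fun_pair => //.
Qed.

Lemma measurable_accept (th : Th) x : in_Theta th -> measurable_fun setT (a th x).
Proof.
by move=> tT; exact: (measurableT_comp (measurable_accept2 tT) (pair1_measurable x)).
Qed.

Lemma measurable_pi_theta (th : Th) : in_Theta th -> measurable_fun setT (p th).
Proof. by move=> tT; apply: param_measurable_fix => //; exact: param_measurable_pi_theta H. Qed.

Let normr_accept th x y : in_Theta th -> `|a th x y| <= q x y.
Proof. by move=> tT; rewrite ger0_norm ?(mh_accept_le H)// (mh_accept_ge0 H). Qed.

Lemma integrable_pi_theta (th : Th) : in_Theta th -> lam.-integrable setT (EFin \o p th).
Proof.
move=> tT; apply: (integrable_bounded lam (M := C / m)).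
  exact: measurable_pi_theta.
by move=> x; rewrite gtr0_norm ?(pi_theta_gt0 H)// (pi_theta_le H).
Qed.

Lemma integrable_accept (th : Th) x : in_Theta th -> lam.-integrable setT (EFin \o a th x).
Proof.
move=> tT; apply: (@integrable_le_proposal x _ 1); first exact: measurable_accept.
by move=> y; rewrite mul1r normr_accept.
Qed.

Section bounded_argument.
Variables (phi : X -> R) (M : R).
Hypotheses (mphi : measurable_fun setT phi) (phiM : forall x, `|phi x| <= M).

Lemma integrable_accept_mul (th : Th) x : in_Theta th ->
  lam.-integrable setT (EFin \o (fun y => a th x y * phi y)).
Proof.
move=> tT; apply: (@integrable_le_proposal x _ M).
  by apply: measurable_funM => //; exact: measurable_accept.
by move=> y; rewrite normrM mulrC ler_pM// normr_accept.
Qed.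

Lemma integrable_pi_theta_mul (th : Th) : in_Theta th ->
  lam.-integrable setT (EFin \o (fun y => p th y * phi y)).
Proof.
move=> tT; apply: (integrable_bounded lam (M := C / m * M)).
  by apply: measurable_funM => //; exact: measurable_pi_theta.
move=> x; rewrite normrM ler_pM// gtr0_norm ?(pi_theta_gt0 H)//.
exact: (pi_theta_le H).
Qed.

Lemma normr_pi_op (th : Th) : in_Theta th -> `|pi_op th phi| <= M.
Proof.
move=> tT.
have i : lam.-integrable setT (EFin \o (fun y => M * p th y)).
  exact: (integrableZl measurableT M (integrable_pi_theta tT)).
rewrite (le_trans (ler_norm_Rintegral (g := fun y => M * p th y) _ i _))//.
- by apply: measurable_funM => //; exact: measurable_pi_theta.
- move=> x; rewrite normrM mulrC ler_pM//.
  by rewrite gtr0_norm// (pi_theta_gt0 H).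
by rewrite RintegralZl ?(pi_op1 H) ?mulr1//; exact: integrable_pi_theta.
Qed.

End bounded_argument.

Let alpha_le1 th x : in_Theta th -> 0 <= 1 - \int[lam]_y a th x y.
Proof.
move=> tT; rewrite subr_ge0 -(Rintegral_proposal x).
apply: le_Rintegral => //; [exact: integrable_accept|exact: integrable_proposal|].
by move=> y _; exact: (mh_accept_le H).
Qed.

(* The Doeblin minorization makes this kernel nonnegative with mass 1 - rho. *)
Definition residual_operator (th : Th) (phi : X -> R) (x : X) : R :=
  mh_op th phi x - rho * pi_op th phi.

Lemma normr_residual_op (th : Th) (phi : X -> R) M x : in_Theta th -> measurable_fun setT phi ->
  (forall y, `|phi y| <= M) -> `|residual_operator th phi x| <= (1 - rho) * M.
Proof.
move=> tT mphi phiM.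
have ia := integrable_accept x tT; have ip := integrable_pi_theta tT.
have irp := integrableZl measurableT rho ip.
have iap := integrable_accept_mul mphi phiM x tT.
have ipp := integrable_pi_theta_mul mphi phiM tT.
have irpp := integrableZl measurableT rho ipp.
have b0 y : 0 <= a th x y - rho * p th y.
  by rewrite subr_ge0 (mh_accept_minorization H).
have -> : residual_operator th phi x = \int[lam]_y ((a th x y - rho * p th y) * phi y)
    + phi x * (1 - \int[lam]_y a th x y).
  rewrite /residual_operator /mh_operator /pi_operator addrAC; congr (_ + _).
  rewrite -RintegralZl// -RintegralB//.
  by apply: eq_Rintegral => y _; rewrite mulrBl mulrA.
have ib : lam.-integrable setT (EFin \o (fun y => a th x y - rho * p th y)).
  exact: (integrableB measurableT ia irp).
have ibM := integrableZl measurableT M ib.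
have I1 : `|\int[lam]_y ((a th x y - rho * p th y) * phi y)|
    <= M * \int[lam]_y (a th x y - rho * p th y).
  rewrite -RintegralZl//; apply: ler_norm_Rintegral => //.
    apply: measurable_funM => //; apply: measurable_funB.
      exact: measurable_accept.
    by apply: measurable_funM => //; exact: measurable_pi_theta.
  by move=> y; rewrite normrM (ger0_norm (b0 y)) mulrC ler_pM.
rewrite (le_trans (ler_normD _ _))//.
rewrite normrM (ger0_norm (alpha_le1 x tT)).
have I2 : \int[lam]_y (a th x y - rho * p th y) = \int[lam]_y a th x y - rho.
  by rewrite RintegralB// RintegralZl// (pi_op1 H)// mulr1.
have := ler_wpM2r (alpha_le1 x tT) (phiM x).
by move: I1; rewrite I2; lra.
Qed.

Lemma normr_mh_op (th : Th) (phi : X -> R) M x : in_Theta th -> measurable_fun setT phi ->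
  (forall y, `|phi y| <= M) -> `|mh_op th phi x| <= M.
Proof.
move=> tT mphi phiM.
have -> : mh_op th phi x = residual_operator th phi x + rho * pi_op th phi.
  by rewrite /residual_operator subrK.
rewrite (le_trans (ler_normD _ _))// normrM (gtr0_norm rho0).
have := normr_residual_op x tT mphi phiM.
have := normr_pi_op mphi phiM tT.
by move=> /(ler_wpM2l (ltW rho0)); lra.
Qed.

(** Applied to the constant 1, the residual bound puts a norm below [1 - rho]. *)
Lemma doeblin_cst_le1 (th : Th) : in_Theta th -> rho <= 1.
Proof.
move=> tT; have := @normr_residual_op th (fun=> 1) 1 point tT (measurable_cst _).
by rewrite normr1 mulr1 => /(_ (fun=> lexx _)) /(le_trans (normr_ge0 _)); rewrite subr_ge0.
Qed.

Lemma pi_op_invariant (th : Th) (phi : X -> R) M : in_Theta th -> measurable_fun setT phi ->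
  (forall y, `|phi y| <= M) -> pi_op th (mh_op th phi) = pi_op th phi.
Proof.
move=> tT mphi phiM.
have M0 : 0 <= M := le_trans (normr_ge0 _) (phiM point).
have B0 : 0 <= C / m by rewrite divr_ge0// ltW.
have pB x : `|p th x| <= C / m.
  by rewrite gtr0_norm ?(pi_theta_gt0 H)// (pi_theta_le H).
have malpha : measurable_fun setT (fun x => \int[lam]_y a th x y).
  exact: (measurable_Rintegral lam (measurable_accept2 tT)).
have maphi : measurable_fun setT (fun x => \int[lam]_y (a th x y * phi y)).
  apply: (measurable_Rintegral lam (h := fun z : X * X => a th z.1 z.2 * phi z.2)).
  apply: measurable_funM; first exact: measurable_accept2.
  exact: (measurableT_comp mphi).
have i1 : lam.-integrable setT
    (EFin \o (fun x => p th x * \int[lam]_y (a th x y * phi y))).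
  apply: (integrable_pi_theta_mul (M := M)) => // x.
  apply: (@Rintegral_le_proposal x).
    by apply: measurable_funM => //; exact: measurable_accept.
  by move=> y; rewrite normrM mulrC ler_pM// normr_accept.
have alpha1 x : `|\int[lam]_y a th x y| <= 1.
  apply: (@Rintegral_le_proposal x); first exact: measurable_accept.
  by move=> y; rewrite mul1r normr_accept.
have i2 : lam.-integrable setT
    (EFin \o (fun x => p th x * (phi x * \int[lam]_y a th x y))).
  apply: (integrable_pi_theta_mul (M := M * 1)) => //; first exact: measurable_funM.
  by move=> x; rewrite normrM ler_pM.
have i3 := integrable_pi_theta_mul mphi phiM tT.
(* Detailed balance and Fubini exchange the two states, so the accepted mass balances the rejection
   term. *)
have f1 : \int[lam]_x (p th x * \int[lam]_y (a th x y * phi y))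
    = \int[lam]_x (p th x * (phi x * \int[lam]_y a th x y)).
  transitivity (\int[lam]_x \int[lam]_y (p th x * (a th x y * phi y))).
    apply: eq_Rintegral => x _; rewrite RintegralZl//.
    exact: (integrable_accept_mul mphi phiM).
  have mf : measurable_fun setT (fun z : X * X => p th z.1 * (a th z.1 z.2 * phi z.2)).
    apply: measurable_funM; first exact: (measurableT_comp (measurable_pi_theta tT)).
    apply: measurable_funM; first exact: measurable_accept2.
    exact: (measurableT_comp mphi).
  (* The symmetry of [q] makes this one bound serve the sections in both variables. *)
  have nf x y : `|p th x * (a th x y * phi y)| <= (C / m * M) * q x y.
    rewrite (normrM (p th x)) (normrM (a th x y)) -(mulrA (C / m)).
    apply: ler_pM => //.
    by rewrite mulrC; apply: ler_pM => //; exact: normr_accept.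
  rewrite (Rintegral_Fubini (f := fun z => p th z.1 * (a th z.1 z.2 * phi z.2)))/=.
  - apply: eq_Rintegral => y _.
    rewrite (mulrC (phi y)) (mulrA (p th y)) -RintegralZl//; last exact: integrable_accept.
    rewrite -RintegralZr//; last first.
      exact: (integrableZl measurableT (p th y) (integrable_accept y tT)).
    by apply: eq_Rintegral => x _; rewrite mulrA (detailed_balance H).
  - apply/(integrable12ltyP lam lam).
      exact/measurable_EFinP.
    apply: (@le_lt_trans _ _ (\int[lam]_x (C / m * M)%:E)%E).
      apply: ge0_le_integral => //.
      + by move=> x _; exact: integral_ge0.
      + have : measurable_fun setT (fubini_F lam (fun z =>
            `|(p th z.1 * (a th z.1 z.2 * phi z.2))%:E|%E)).
          apply: measurable_fun_fubini_tonelli_F => [|z]; last exact: abse_ge0.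
          by apply: measurableT_comp => //; exact/measurable_EFinP.
        exact.
      + move=> x _; apply: (@le_trans _ _ (\int[lam]_y ((C / m * M) * q x y)%:E)%E).
          apply: ge0_le_integral => //.
          * apply: measurableT_comp => //; apply/measurable_EFinP.
            exact: (measurableT_comp mf (pair1_measurable x)).
          * apply/measurable_EFinP; apply: measurable_funM => //.
            exact: measurable_proposal.
          * by move=> y _ /=; rewrite lee_fin.
        under eq_integral do rewrite EFinM.
        by rewrite integralZl ?(wl_q1 H) ?mule1//; exact: integrable_proposal.
    rewrite integral_cst//; apply: lte_mul_pinfty => //.
      by rewrite lee_fin mulr_ge0.
    exact: fin_num_fun_lty.
  - move=> x; apply: (@integrable_le_proposal x _ (C / m * M)) => //.
    exact: (measurableT_comp mf (pair1_measurable x)).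
  - move=> y; apply: (@integrable_le_proposal y _ (C / m * M)).
      exact: (measurableT_comp mf (pair2_measurable y)).
    by move=> x; rewrite (wl_qsym H).
rewrite /pi_operator /mh_operator.
transitivity (\int[lam]_x (p th x * \int[lam]_y (a th x y * phi y) +
   (p th x * phi x - p th x * (phi x * \int[lam]_y a th x y)))).
  by apply: eq_Rintegral => x _; rewrite mulrDr !mulrBr mulr1.
rewrite RintegralD//; last exact: (integrableB measurableT i3 i2).
by rewrite RintegralB// f1 addrC subrK.
Qed.

End operators.

(** * The Poisson equation *)

Section poisson.
Context {R : realType} {d : nat} {dX : measure_display} {X : measurableType dX}.
Variables (lam : {finite_measure set X -> \bar R}) (pi : X -> R) (I : X -> 'I_d)
  (q : X -> X -> R).

Notation Th := ('I_d -> R).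
Notation p := (pi_theta lam pi I).
Notation a := (mh_accept lam pi I q).
Notation pi_op := (pi_operator lam pi I).
Notation mh_op := (mh_operator lam pi I q).
Variables (C m cq g1 : R).
Notation rho := (doeblin_cst C m cq).
Notation residual_op := (residual_operator lam pi I q C m cq).
Hypothesis H : wl_setting lam pi I q C m cq.
Hypothesis g11 : g1 < 1.
Hypothesis Th0 : exists th : Th, in_Theta th.

Let rho0 : 0 < rho := doeblin_cst_gt0 H.
Let rho1 : rho <= 1. Proof. by have [th /(doeblin_cst_le1 H)] := Th0. Qed.
Let K := 2 / (1 - g1).
Let K0 : 0 < K. Proof. by rewrite divr_gt0// subr_gt0. Qed.

(** A class preserved by the operators below, with constants uniform in the state so that they can
    be tracked through iterations. The range [g <= g1] covers every step of the algorithm. *)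
Record regular_fun (F : Th -> X -> R) (M L : R) : Prop := {
  regular_measurable : param_measurable F;
  regular_bounded : forall (th : Th) x, in_Theta th -> `|F th x| <= M;
  regular_L0 : 0 <= L;
  regular_close : forall (g : R) (th th' : Th) x, 0 <= g <= g1 -> in_Theta th -> in_Theta th' ->
    param_close g th th' -> `|F th x - F th' x| <= L * g }.

Lemma regular_fix F M L th : regular_fun F M L -> in_Theta th ->
  measurable_fun setT (F th).
Proof. by move=> [mF _ _ _]; exact: param_measurable_fix. Qed.

Lemma regular_ge0 F M L : regular_fun F M L -> 0 <= M.
Proof.
move=> [_ bF _ _]; have [th tT] := Th0.
exact: le_trans (normr_ge0 _) (bF th point tT).
Qed.

Lemma mh_opB (th : Th) (phi psi : X -> R) M N x : in_Theta th ->
  measurable_fun setT phi -> (forall y, `|phi y| <= M) ->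
  measurable_fun setT psi -> (forall y, `|psi y| <= N) ->
  mh_op th phi x - mh_op th psi x = mh_op th (fun y => phi y - psi y) x.
Proof.
move=> tT mphi phiM mpsi psiN.
have i1 := integrable_accept_mul H mphi phiM x tT.
have i2 := integrable_accept_mul H mpsi psiN x tT.
have e : \int[lam]_y (a th x y * (phi y - psi y)) =
    \int[lam]_y (a th x y * phi y) - \int[lam]_y (a th x y * psi y).
  by rewrite -RintegralB//; apply: eq_Rintegral => y _; rewrite mulrBr.
by rewrite /mh_operator e; ring.
Qed.

Lemma pi_opB (th : Th) (phi psi : X -> R) M N : in_Theta th ->
  measurable_fun setT phi -> (forall y, `|phi y| <= M) ->
  measurable_fun setT psi -> (forall y, `|psi y| <= N) ->
  pi_op th phi - pi_op th psi = pi_op th (fun y => phi y - psi y).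
Proof.
move=> tT mphi phiM mpsi psiN.
have i1 := integrable_pi_theta_mul H mphi phiM tT.
have i2 := integrable_pi_theta_mul H mpsi psiN tT.
rewrite /pi_operator -RintegralB//; apply: eq_Rintegral => y _.
by rewrite mulrBr.
Qed.

Lemma residual_opB (th : Th) (phi psi : X -> R) M N x : in_Theta th ->
  measurable_fun setT phi -> (forall y, `|phi y| <= M) ->
  measurable_fun setT psi -> (forall y, `|psi y| <= N) ->
  residual_op th phi x - residual_op th psi x
  = residual_op th (fun y => phi y - psi y) x.
Proof.
move=> tT mphi phiM mpsi psiN; rewrite /residual_operator.
rewrite -(mh_opB x tT mphi phiM mpsi psiN) -(pi_opB tT mphi phiM mpsi psiN).
by ring.
Qed.

Section change_of_parameter.
Variables (g : R) (th th' : Th) (phi : X -> R) (M : R).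
Hypotheses (g01 : 0 <= g <= g1) (tT : in_Theta th) (tT' : in_Theta th').
Hypotheses (ct : param_close g th th') (mphi : measurable_fun setT phi).
Hypothesis phiM : forall y, `|phi y| <= M.

Let M0 : 0 <= M. Proof. exact: le_trans (normr_ge0 _) (phiM point). Qed.
Let g0 : 0 <= g. Proof. by case/andP: g01. Qed.

Lemma mh_op_close x : `|mh_op th phi x - mh_op th' phi x| <= 2 * K * M * g.
Proof.
have iq := integrable_proposal H x.
have i1 := integrable_accept_mul H mphi phiM x tT.
have i2 := integrable_accept_mul H mphi phiM x tT'.
have j1 := integrable_accept H x tT.
have j2 := integrable_accept H x tT'.
have ma := measurable_accept H x tT; have ma' := measurable_accept H x tT'.
have c y : `|a th x y - a th' x y| <= K * g * q x y.
  exact: (mh_accept_close H g01 g11 tT tT' ct).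
have h (f : X -> R) : measurable_fun setT f -> (forall y, `|f y| <= M) ->
    `|\int[lam]_y ((a th x y - a th' x y) * f y)| <= K * g * M.
  move=> mf fM.
  rewrite (le_trans (ler_norm_Rintegral (g := fun y => (K * g * M) * q x y) _ _ _))//.
  - by apply: measurable_funM => //; exact: measurable_funB.
  - exact: (integrableZl measurableT (K * g * M) iq).
  - by move=> y; rewrite normrM mulrAC ler_pM.
  by rewrite RintegralZl// (Rintegral_proposal H) mulr1.
(* The factor 2: the accepted density and the rejection mass each contribute [K * M * g]. *)
have e : mh_op th phi x - mh_op th' phi x =
    \int[lam]_y ((a th x y - a th' x y) * phi y) -
    \int[lam]_y ((a th x y - a th' x y) * phi x).
  have -> : \int[lam]_y ((a th x y - a th' x y) * phi y) =
      \int[lam]_y (a th x y * phi y) - \int[lam]_y (a th' x y * phi y).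
    by rewrite -RintegralB//; apply: eq_Rintegral => y _; rewrite mulrBl.
  rewrite RintegralZr//; last exact: (integrableB measurableT j1 j2).
  by rewrite RintegralB// /mh_operator; ring.
rewrite e (le_trans (ler_normB _ _))//.
have := h _ mphi phiM; have := h (fun=> phi x) (measurable_cst _) (fun=> phiM x).
by lra.
Qed.

Lemma pi_op_close : `|pi_op th phi - pi_op th' phi| <= K * M * g.
Proof.
have i1 := integrable_pi_theta_mul H mphi phiM tT.
have i2 := integrable_pi_theta_mul H mphi phiM tT'.
have i3 := integrable_pi_theta H tT'.
rewrite /pi_operator -RintegralB//.
rewrite (le_trans (ler_norm_Rintegral (g := fun y => (K * M * g) * p th' y) _ _ _))//.
- by apply: measurable_funB; apply: measurable_funM => //; exact: (measurable_pi_theta H).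
- exact: (integrableZl measurableT (K * M * g) i3).
- move=> y; rewrite -mulrBl normrM.
  have -> : K * M * g * p th' y = (K * g * p th' y) * M by ring.
  by apply: ler_pM => //; exact: (pi_theta_close H g01 g11 tT tT' ct).
by rewrite RintegralZl// (pi_op1 H)// mulr1.
Qed.

Lemma residual_op_close x :
  `|residual_op th phi x - residual_op th' phi x| <= 3 * K * M * g.
Proof.
rewrite /residual_operator.
have -> : mh_op th phi x - rho * pi_op th phi - (mh_op th' phi x - rho * pi_op th' phi)
  = (mh_op th phi x - mh_op th' phi x) - rho * (pi_op th phi - pi_op th' phi).
  by ring.
rewrite (le_trans (ler_normB _ _))// normrM (gtr0_norm rho0).
have := mh_op_close x; have := pi_op_close.
have := normr_ge0 (pi_op th phi - pi_op th' phi); move: rho0 rho1; nra.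
Qed.

End change_of_parameter.

Lemma param_measurable_pi_op (F : Th -> X -> R) : param_measurable F ->
  param_measurable (fun th (_ : X) => pi_op th (F th)).
Proof.
move=> mF dT T th mth tT.
apply: (measurableT_comp (f := fun t => pi_op (th t) (F (th t)))) => //.
apply: (measurable_Rintegral lam (h := fun z => p (th z.1) z.2 * F (th z.1) z.2)).
by apply: measurable_funM; [exact: (param_measurable_pi_theta H)|exact: mF].
Qed.

Lemma param_measurable_mh_op (F : Th -> X -> R) : param_measurable F ->
  param_measurable (fun th => mh_op th (F th)).
Proof.
move=> mF dT T th mth tT.
have ma := measurable_mh_accept H mth tT.
apply: measurable_funD.
  apply: (measurable_Rintegral lam
    (h := fun z => a (th z.1.1) z.1.2 z.2 * F (th z.1.1) z.2)).
  apply: measurable_funM => //.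
  apply: (mF _ _ (fun z : T * X => th z.1)) => // i.
  exact: (measurableT_comp (mth i)).
apply: measurable_funM; first exact: mF.
apply: measurable_funB => //.
exact: (measurable_Rintegral lam (h := fun z => a (th z.1.1) z.1.2 z.2)).
Qed.

Lemma regular_mh_op F M L : regular_fun F M L ->
  regular_fun (fun th => mh_op th (F th)) M (L + 2 * K * M).
Proof.
move=> rF; have [mF bF F0 cF] := rF; split.
- exact: param_measurable_mh_op.
- move=> th x tT; apply: (normr_mh_op H) => //; first exact: (regular_fix rF).
  by move=> y; exact: bF.
- have M0 := regular_ge0 rF.
  have K1 := ltW K0; have k0 : 0 <= 2 * K * M by rewrite mulr_ge0// mulr_ge0.
  exact: addr_ge0.
- move=> g th th' x g01 tT tT' ct.
  have mt := regular_fix rF tT; have mt' := regular_fix rF tT'.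
  rewrite (_ : _ - _ = (mh_op th (F th) x - mh_op th (F th') x)
    + (mh_op th (F th') x - mh_op th' (F th') x)); last by ring.
  rewrite (le_trans (ler_normD _ _))// mulrDl lerD//; last first.
    by apply: mh_op_close => // y; exact: bF.
  rewrite (mh_opB _ tT mt (M := M) _ mt' (N := M)); try by move=> y; exact: bF.
  apply: (normr_mh_op H) => //; first exact: measurable_funB.
  by move=> y; exact: cF.
Qed.

Lemma regular_residual_op F M L : regular_fun F M L ->
  regular_fun (fun th => residual_op th (F th)) ((1 - rho) * M)
    ((1 - rho) * L + 3 * K * M).
Proof.
move=> rF; have [mF bF F0 cF] := rF; split.
- move=> dT T th mth tT; apply: measurable_funB.
    exact: (param_measurable_mh_op mF mth tT).
  apply: measurable_funM => //.
  exact: (param_measurable_pi_op mF mth tT).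
- move=> th x tT; apply: (normr_residual_op H) => //; first exact: (regular_fix rF).
  by move=> y; exact: bF.
- have M0 := regular_ge0 rF.
  have K1 := ltW K0; have k0 : 0 <= 3 * K * M by rewrite mulr_ge0// mulr_ge0.
  by apply: addr_ge0 => //; rewrite mulr_ge0// subr_ge0.
- move=> g th th' x g01 tT tT' ct.
  have mt := regular_fix rF tT; have mt' := regular_fix rF tT'.
  rewrite (_ : _ - _ = (residual_op th (F th) x - residual_op th (F th') x)
    + (residual_op th (F th') x - residual_op th' (F th') x)); last by ring.
  rewrite (le_trans (ler_normD _ _))// mulrDl lerD//; last first.
    by apply: residual_op_close => // y; exact: bF.
  rewrite (residual_opB _ tT mt (M := M) _ mt' (N := M)); try by move=> y; exact: bF.
  rewrite -mulrA; apply: (normr_residual_op H) => //; first exact: measurable_funB.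
  by move=> y; exact: cF.
Qed.

(** By invariance, pi R = pi P - rho pi, with pi P = pi. *)
Lemma pi_op_residual F M L th : regular_fun F M L -> in_Theta th ->
  pi_op th (residual_op th (F th)) = (1 - rho) * pi_op th (F th).
Proof.
move=> rF tT; have [mF bF F0 cF] := rF; have mt := regular_fix rF tT.
have rP := regular_mh_op rF.
have bt y : `|F th y| <= M by exact: bF.
rewrite -(pi_opB tT (regular_fix rP tT) (M := M) _ (measurable_cst _)
  (N := `|rho * pi_op th (F th)|))//; last first.
  by move=> y; exact: (regular_bounded rP).
rewrite (pi_op_invariant H tT mt bt).
rewrite [X in _ - X = _](_ : _ = rho * pi_op th (F th)); first by ring.
rewrite {1}/pi_operator RintegralZr ?(pi_op1 H) ?mul1r//.
exact: (integrable_pi_theta H).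
Qed.

Lemma regularD F G M N L J : regular_fun F M L -> regular_fun G N J ->
  regular_fun (fun th x => F th x + G th x) (M + N) (L + J).
Proof.
move=> [mF bF F0 cF] [mG bG G0 cG]; split.
- by move=> dT T th mth tT; apply: measurable_funD; [exact: mF|exact: mG].
- by move=> th x tT; rewrite (le_trans (ler_normD _ _))// lerD// ?bF ?bG.
- exact: addr_ge0.
- move=> g th th' x g01 tT tT' ct; rewrite opprD addrACA mulrDl.
  by rewrite (le_trans (ler_normD _ _))// lerD// ?cF ?cG.
Qed.

Section solution.
Variables (F : Th -> X -> R) (M L : R).
Hypothesis rF : regular_fun F M L.

Let M0 : 0 <= M := regular_ge0 rF.

(** These are the partial sums of the Neumann series of the R_theta^j F. *)
Fixpoint picard (k : nat) (th : Th) (x : X) : R :=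
  if k is k'.+1 then F th x + residual_op th (picard k' th) x else 0.

(** The bounds [M / rho] and [LS] solve B = M + (1 - rho) B and A = L + (1 - rho) A + 3 K B, so one
    Picard step preserves them. *)
Let LS := (L + 3 * K * (M / rho)) / rho.

Let Mrho : 0 <= M / rho. Proof. by rewrite divr_ge0// ltW. Qed.

Lemma regular_picard k : regular_fun (picard k) (M / rho) LS.
Proof.
elim: k => [|k IH].
  have LS0 : 0 <= LS.
    rewrite divr_ge0 ?(ltW rho0)// addr_ge0 ?(regular_L0 rF)//.
    by rewrite mulr_ge0// mulr_ge0// ltW.
  split=> //.
  - by move=> th x _; rewrite normr0.
  - by move=> g th th' x /andP[g0 _] _ _ _; rewrite subrr normr0 mulr_ge0.
have := regularD rF (regular_residual_op IH).
by congr regular_fun; rewrite /LS; field; rewrite gt_eqF.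
Qed.

Lemma picard_step k th x : in_Theta th ->
  `|picard k.+1 th x - picard k th x| <= (1 - rho) ^+ k * M.
Proof.
move=> tT; elim: k x => [|k IH] x.
  rewrite /= subr0 expr0 mul1r.
  have -> : residual_op th (fun=> 0) x = 0.
    have z (h : X -> R) : \int[lam]_y (h y * 0) = 0.
      by under eq_Rintegral do rewrite mulr0; rewrite Rintegral_cst// mul0r.
    by rewrite /residual_operator /mh_operator /pi_operator !z; ring.
  by rewrite addr0; exact: (regular_bounded rF).
rewrite [picard k.+2 th x]/= [in X in _ - X]/= opprD addrACA subrr add0r.
have r1 := regular_picard k.+1; have r0 := regular_picard k.
rewrite (residual_opB _ tT (regular_fix r1 tT) (M := M / rho) _
  (regular_fix r0 tT) (N := M / rho)); first last.
- by move=> y; exact: (regular_bounded r0).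
- by move=> y; exact: (regular_bounded r1).
rewrite exprS -mulrA; apply: (normr_residual_op H) => //.
by apply: measurable_funB; [exact: (regular_fix r1)|exact: (regular_fix r0)].
Qed.

Lemma picard_dist k j th x : in_Theta th ->
  `|picard (k + j) th x - picard k th x| <= (1 - rho) ^+ k * (M / rho).
Proof.
move=> tT.
have r0 : 0 <= 1 - rho by rewrite subr_ge0.
(* The exact geometric sum is kept, because the bound without its last factor is not inductive. *)
suff h : `|picard (k + j) th x - picard k th x|
    <= (1 - rho) ^+ k * (M / rho) * (1 - (1 - rho) ^+ j).
  have h0 : 0 <= (1 - rho) ^+ k * (M / rho) by rewrite mulr_ge0// exprn_ge0.
  by rewrite (le_trans h)// ler_piMr// gerBl exprn_ge0.
elim: j => [|j IH].
  by rewrite addn0 expr0 !subrr normr0 mulr0.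
rewrite addnS.
have -> : picard (k + j).+1 th x - picard k th x =
  (picard (k + j).+1 th x - picard (k + j) th x) + (picard (k + j) th x - picard k th x).
  by ring.
rewrite (le_trans (ler_normD _ _))//.
rewrite (le_trans (lerD (picard_step _ _ tT) IH))// exprD exprS.
rewrite le_eqVlt; apply/orP; left; apply/eqP.
by field; rewrite gt_eqF.
Qed.

Definition poisson (th : Th) (x : X) : R := limn (fun k => picard k th x).

Let cvg_expr_rho (c : R) : (fun k => (1 - rho) ^+ k * c) @ \oo --> 0.
Proof.
rewrite -(mul0r c); apply: cvgMr_tmp; apply: cvg_expr.
by rewrite ger0_norm ?subr_ge0// gtrBl.
Qed.

Lemma cvg_picard th x : in_Theta th ->
  (fun k => picard k th x) @ \oo --> poisson th x.
Proof.
move=> tT; suff : cvgn (fun k => picard k th x) by [].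
apply: cvgn_cauchy => e e0.
have [N _ hN] := cvgr_lt _ (cvg_expr_rho (M / rho)) _ e0.
exists N => n /subnKC <-; rewrite (le_trans (picard_dist _ _ _ tT))// ltW//.
exact: (hN N (leqnn N)).
Qed.

Lemma poisson_dist k th x : in_Theta th ->
  `|poisson th x - picard k th x| <= (1 - rho) ^+ k * (M / rho).
Proof.
move=> tT.
have c : (fun n => `|picard n th x - picard k th x|) @ \oo -->
    `|poisson th x - picard k th x|.
  by apply: cvg_norm; apply: cvgB; [exact: cvg_picard|exact: cvg_cst].
rewrite -(cvg_lim _ c)//; apply: limr_le; first by apply/cvg_ex; eexists; exact: c.
by exists k => // n /= /subnKC <-; exact: picard_dist.
Qed.

Lemma regular_poisson : regular_fun poisson (M / rho) LS.
Proof.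
split.
- move=> dT T th mth tT.
  apply: (measurable_fun_cvg (h := fun k z => picard k (th z.1) z.2)).
    by move=> k; exact: (regular_measurable (regular_picard k)).
  by move=> z _; exact: cvg_picard.
- move=> th x tT; have := poisson_dist 0 x tT.
  by rewrite subr0 expr0 mul1r.
- exact: (regular_L0 (regular_picard 0)).
- move=> g th th' x g01 tT tT' ct.
  have c : (fun n => `|picard n th x - picard n th' x|) @ \oo -->
      `|poisson th x - poisson th' x|.
    by apply: cvg_norm; apply: cvgB; exact: cvg_picard.
  rewrite -(cvg_lim _ c)//; apply: limr_le; first by apply/cvg_ex; eexists; exact: c.
  by apply: nearW => n; exact: (regular_close (regular_picard n)).
Qed.

(** The Picard iterates converge uniformly in the state, so the residual operator, a contraction for
    the sup norm, passes to the limit. *)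
Let poisson_fixpoint th x : in_Theta th ->
  poisson th x = F th x + residual_op th (poisson th) x.
Proof.
move=> tT; apply/eqP; rewrite -subr_eq0 -normr_le0; apply/ler_addgt0Pl => e e0.
rewrite addr0.
have e2 : 0 < e / 2 by rewrite divr_gt0.
have [k _ hk] := cvgr_lt _ (cvg_expr_rho (M / rho)) _ e2.
have {hk}hk : (1 - rho) ^+ k * (M / rho) < e / 2 by exact: (hk k (leqnn k)).
have rk := regular_fix (regular_picard k) tT.
have rp := regular_fix regular_poisson tT.
have bk y := regular_bounded (regular_picard k) y tT.
have bp y := regular_bounded regular_poisson y tT.
have dk y : `|picard k th y - poisson th y| <= e / 2.
  by rewrite distrC (le_trans (poisson_dist _ _ tT))// ltW.
have : `|residual_op th (picard k th) x - residual_op th (poisson th) x| <= (1 - rho) * (e / 2).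
  rewrite (residual_opB _ tT rk bk rp bp).
  apply: (normr_residual_op H) => //; exact: measurable_funB.
have := poisson_dist k.+1 x tT; rewrite exprS /=.
have h : 0 <= (1 - rho) ^+ k * (M / rho).
  by rewrite mulr_ge0// exprn_ge0// subr_ge0.
have : (1 - rho) * (1 - rho) ^+ k * (M / rho) <= (1 - rho) ^+ k * (M / rho).
  by rewrite -mulrA ler_piMl// gerBl ltW.
have : (1 - rho) * (e / 2) <= e / 2 by rewrite ler_piMl ?(ltW e2)// gerBl ltW.
move: hk; set A := residual_op th (picard k th) x; set B := residual_op th _ x.
set D' := (1 - rho) * _ * _; set D := (1 - rho) ^+ k * _; set E := (1 - rho) * (e / 2).
by rewrite !ler_norml => h1 h2 h3 /andP[? ?] /andP[? ?]; apply/andP; split; lra.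
Qed.

(* The fixed point of F + R(.) is not centred, but integrating it against the
   invariant density identifies the constant: rho pi(poisson) = pi(F). *)
Lemma poisson_equation th x : in_Theta th ->
  F th x - pi_op th (F th) = poisson th x - mh_op th (poisson th) x.
Proof.
move=> tT; have rp := regular_poisson.
have mF := regular_fix rF tT.
have mp := regular_fix rp tT.
have bF y := regular_bounded rF y tT.
have bp y := regular_bounded rp y tT.
have rr := regular_fix (regular_residual_op rp) tT.
have br y := regular_bounded (regular_residual_op rp) y tT.
have e : rho * pi_op th (poisson th) = pi_op th (F th).
  have : pi_op th (poisson th) - pi_op th (residual_op th (poisson th)) = pi_op th (F th).
    rewrite (pi_opB tT mp bp rr br); congr (pi_operator lam pi I th _).
    by apply/funext => y; rewrite [in LHS]poisson_fixpoint// addrK.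
  by rewrite (pi_op_residual rp tT) => <-; ring.
by rewrite [in RHS](poisson_fixpoint x tT) -e /residual_operator; ring.
Qed.

End solution.

End poisson.

(** * Series of bounded martingale increments *)

Section martingale.
Context {R : realType} {dO : measure_display} {Omega : measurableType dO}.
Variables (P : probability Omega R) (Gen : nat -> set (set Omega)).

Definition adapted (n : nat) (Y : Omega -> R) :=
  measurable_fun (setT : set (g_sigma_algebraType (Gen n))) (Y : g_sigma_algebraType (Gen n) -> R).

Hypothesis Gen_measurable : forall n, Gen n `<=` measurable.
Hypothesis Gen_mono : forall n, Gen n `<=` Gen n.+1.

Lemma adapted_measurable n Y : adapted n Y -> measurable_fun setT Y.
Proof.
move=> aY _ U mU; have := aY measurableT U mU; rewrite !setTI.
apply: smallest_sub; last exact: Gen_measurable.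
exact: sigma_algebra_measurable.
Qed.

Lemma adaptedS n Y : adapted n Y -> adapted n.+1 Y.
Proof.
move=> aY _ U mU; have := aY measurableT U mU; rewrite !setTI.
by apply: sub_sigma_algebra2; exact: Gen_mono.
Qed.

Variables (al : nat -> R) (zeta : nat -> Omega -> R) (K : R).
Hypothesis al2 : cvgn (series (fun k => al k ^+ 2)).
Hypothesis zeta_adapted : forall k, adapted k.+1 (zeta k).
Hypothesis zetaK : forall k w, `|zeta k w| <= K.
(** This replaces E(zeta_k | F_k) = 0; note that [zeta k] itself belongs to time k + 1. *)
Hypothesis zeta_orth : forall k Y, adapted k Y -> (exists M, forall w, `|Y w| <= M) ->
  \int[P]_w (Y w * zeta k w) = 0.

Let K0 : 0 <= K. Proof. exact: le_trans (normr_ge0 _) (zetaK 0 point). Qed.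
Let b k w := al k * zeta k w.

(* The partial sums started at time m, frozen once they reach level e. *)
Fixpoint stopped_sum (m : nat) (e : R) (i : nat) (w : Omega) : R :=
  if i is i'.+1 then
    stopped_sum m e i' w + (`|stopped_sum m e i' w| < e)%R%:R * b (m + i')%N w
  else 0.

Let S := stopped_sum.

Let below_adapted n (Y : Omega -> R) e : adapted n Y ->
  adapted n (fun w => (`|Y w| < e)%R%:R).
Proof.
move=> aY; rewrite (_ : (fun w => _) = \1_[set w | `|Y w| < e]); last first.
  apply/funext => w; rewrite indicE; congr (_%:R); congr nat_of_bool.
  by apply/idP/idP => [h|/set_mem//]; exact/mem_set.
apply: measurable_indic.
rewrite (_ : [set _ | _] = setT `&` (fun w => `|Y w|) @^-1` `]-oo, e[%classic).
  exact: (measurableT_comp _ aY).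
by rewrite setTI; apply/seteqP; split => w /=; rewrite in_itv.
Qed.

Let S_adapted m e i : adapted (m + i) (S m e i) /\ exists M, forall w, `|S m e i w| <= M.
Proof.
elim: i => [|i [IHa [M IHb]]].
  by split; [exact: measurable_cst|exists 0 => w; rewrite normr0].
split.
  rewrite addnS; apply: measurable_funD; first exact: adaptedS.
  apply: measurable_funM; last by apply: measurable_funM => //; exact: zeta_adapted.
  exact: below_adapted (adaptedS IHa).
exists (M + `|al (m + i)%N| * K) => w /=.
rewrite (le_trans (ler_normD _ _))// lerD// normrM /b normrM.
rewrite -[leRHS]mul1r ler_pM ?mulr_ge0// ?ler_pM//.
by case: (_ < _); rewrite ?normr1 ?normr0.
Qed.

(** The freezing factor [c] depends only on the past, so the cross term vanishes by orthogonality
    and the squares add up. *)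
Let S_sqr m e i : \int[P]_w (S m e i w ^+ 2) <= K ^+ 2 * \sum_(k < i) al (m + k)%N ^+ 2.
Proof.
elim: i => [|i IH].
  rewrite big_ord0 mulr0 (_ : (fun w => _) = cst 0) ?Rintegral_cst ?mul0r//.
  by apply/funext => w; rewrite /= expr0n.
have [aS [M SM]] := S_adapted m e i.
have [_ [M' SM']] := S_adapted m e i.+1.
have mS := adapted_measurable aS.
have mS' := adapted_measurable (S_adapted m e i.+1).1.
pose c w : R := (`|S m e i w| < e)%R%:R.
have c01 w : 0 <= c w <= 1 by rewrite /c; case: (_ < _); rewrite ?lexx ler01.
have ac : adapted (m + i) c by exact: below_adapted.
have mc := adapted_measurable ac.
have mz := adapted_measurable (@zeta_adapted (m + i)%N).
have i1 : P.-integrable setT (EFin \o (fun w => S m e i w ^+ 2)).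
  apply: (integrable_bounded P (M := M ^+ 2)); first exact: measurable_funX.
  by move=> w; rewrite normrX ler_sqr ?nnegrE// (le_trans _ (SM w)).
have i2 : P.-integrable setT
    (EFin \o (fun w => (2 * al (m + i)%N * S m e i w * c w) * zeta (m + i)%N w)).
  apply: (integrable_bounded P (M := (2 * `|al (m + i)%N| * M * 1) * K)).
    by do ! apply: measurable_funM => //.
  move=> w; have /andP[c0 c1] := c01 w; rewrite !normrM (ger0_norm c0) (@ger0_norm _ 2)//.
  by do ! (apply: ler_pM; rewrite ?mulr_ge0//).
have i3 : P.-integrable setT (EFin \o (fun w => c w * b (m + i)%N w ^+ 2)).
  apply: (integrable_bounded P (M := 1 * (`|al (m + i)%N| * K) ^+ 2)).
    by apply: measurable_funM => //; apply: measurable_funX; exact: measurable_funM.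
  move=> w; have /andP[c0 c1] := c01 w; rewrite normrM (ger0_norm c0) normrX.
  rewrite ler_pM ?exprn_ge0// ler_sqr ?nnegrE ?mulr_ge0//.
  by rewrite /b normrM ler_pM.
have -> : \int[P]_w (S m e i.+1 w ^+ 2) = \int[P]_w (S m e i w ^+ 2) +
    (\int[P]_w ((2 * al (m + i)%N * S m e i w * c w) * zeta (m + i)%N w) +
     \int[P]_w (c w * b (m + i)%N w ^+ 2)).
  rewrite -RintegralD// -RintegralD//; last exact: (integrableD measurableT i2 i3).
  apply: eq_Rintegral => w _.
  have cc : c w ^+ 2 = c w by rewrite /c; case: (_ < _); rewrite ?expr0n ?expr1n.
  transitivity ((S m e i w + c w * b (m + i)%N w) ^+ 2) => //.
  by rewrite sqrrD exprMn cc /b; ring.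
rewrite zeta_orth; last 2 first.
- by do ! apply: measurable_funM => //.
- exists (2 * `|al (m + i)%N| * M * 1) => w.
  have /andP[c0 c1] := c01 w; rewrite !normrM (ger0_norm c0) (@ger0_norm _ 2)//.
  by do ! (apply: ler_pM; rewrite ?mulr_ge0//).
rewrite add0r big_ord_recr mulrDr lerD//=.
have := @ler_norm_Rintegral _ _ _ P (fun w => c w * b (m + i)%N w ^+ 2)
  (fun=> K ^+ 2 * al (m + i)%N ^+ 2).
rewrite Rintegral_cst// (_ : fine _ = 1) ?mulr1; last first.
  exact: (congr1 fine (@probability_setT _ _ _ P)).
move=> h.
apply: (le_trans (ler_norm _)); apply: h.
- by apply: measurable_funM => //; apply: measurable_funX; exact: measurable_funM.
- exact: finite_measure_integrable_cst.
- move=> w; have /andP[c0 c1] := c01 w; rewrite normrM (ger0_norm c0) normrX.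
  rewrite -[leRHS]mul1r; apply: ler_pM => //; try exact: exprn_ge0.
  rewrite /b normrM exprMn mulrC; apply: ler_pM; rewrite ?exprn_ge0//.
    by rewrite ler_sqr ?nnegrE.
  by rewrite real_normK ?num_real.
Qed.

Let level m e i := [set w | e <= `|S m e i w|].

Let mlevel m e i : measurable (level m e i).
Proof.
have mS := adapted_measurable (S_adapted m e i).1.
rewrite /level (_ : [set _ | _] = setT `&` (fun w => `|S m e i w|) @^-1` `[e, +oo[%classic).
  exact: (measurableT_comp _ mS).
by rewrite setTI; apply/seteqP; split => w /=; rewrite in_itv/= andbT.
Qed.

Let P_level m e i : 0 < e ->
  (P (level m e i) <= (e ^- 2 * (K ^+ 2 * \sum_(k < i) al (m + k)%N ^+ 2))%:E)%E.
Proof.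
move=> e0; have [aS [M SM]] := S_adapted m e i; have mS := adapted_measurable aS.
rewrite -[P _]fineK ?fin_num_measure// lee_fin ler_pdivlMl ?exprn_gt0//.
rewrite (le_trans _ (S_sqr m e i))//.
have -> : fine (P (level m e i)) = \int[P]_w (\1_(level m e i) w).
  by rewrite /Rintegral integral_indic ?setIT.
have ii : P.-integrable setT (EFin \o (\1_(level m e i) : _ -> R)).
  apply: (integrable_bounded P (M := 1)); first exact: measurable_indic.
  by move=> w; rewrite indicE; case: (_ \in _); rewrite ?normr1 ?normr0.
rewrite -RintegralZl//; apply: le_Rintegral => //.
- exact: (integrableZl measurableT (e ^+ 2) ii).
- apply: (integrable_bounded P (M := M ^+ 2)); first exact: measurable_funX.
  by move=> w; rewrite normrX ler_sqr ?nnegrE// (le_trans _ (SM w)).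
- move=> w _; rewrite indicE; case: (boolP (w \in _)) => [/set_mem/= h|_].
    by rewrite mulr1 -[leRHS]real_normK ?num_real// ler_sqr ?nnegrE// ltW.
  by rewrite mulr0 sqr_ge0.
Qed.

(** A frozen sum never moves again, so the event of having reached the level is already seen at the
    last index. The Chebyshev bound [P_level] thus becomes a maximal inequality. *)
Let level_incr m e : nondecreasing_seq (level m e).
Proof.
apply/nondecreasing_seqP => i; apply/subsetPset => w /= h.
by rewrite /level/= ltNge h mul0r addr0.
Qed.

Let below_level m e i w : `|S m e i w| < e -> S m e i w = \sum_(k < i) b (m + k)%N w.
Proof.
elim: i => [|i IH]; first by rewrite big_ord0.
rewrite [S _ _ i.+1 w]/= big_ord_recr /=.
have [h|h] := ltP `|S m e i w| e; first by rewrite -/S mul1r IH.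
by rewrite -/S mul0r addr0 ltNge h.
Qed.

Let tail m := (limn (series (fun k => al k ^+ 2)) - series (fun k => al k ^+ 2) m).

Let sum_le_tail m i : \sum_(k < i) al (m + k)%N ^+ 2 <= tail m.
Proof.
have -> : \sum_(k < i) al (m + k)%N ^+ 2 =
    series (fun k => al k ^+ 2) (m + i)%N - series (fun k => al k ^+ 2) m.
  by rewrite series_shift.
rewrite /tail lerD2r; apply: nondecreasing_cvgn_le => //.
by apply: nondecreasing_series => k _ _; exact: sqr_ge0.
Qed.

Let exceed m e := \bigcup_i level m e i.

Let P_exceed m e : 0 < e -> (P (exceed m e) <= (e ^- 2 * (K ^+ 2 * tail m))%:E)%E.
Proof.
move=> e0.
have cv : (P \o level m e) @ \oo --> P (exceed m e).
  apply: nondecreasing_cvg_mu => //; first exact: bigcupT_measurable.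
rewrite -(cvg_lim _ cv)//; apply: lime_le; first by apply/cvg_ex; eexists; exact: cv.
apply: nearW => i /=; rewrite (le_trans (P_level m i e0))// lee_fin.
by rewrite ler_pM2l ?invr_gt0 ?exprn_gt0// ler_wpM2l ?sqr_ge0.
Qed.

Let tail_cvg : tail @ \oo --> 0.
Proof.
rewrite -(subrr (limn (series (fun k => al k ^+ 2)))).
by apply: cvgB; [exact: cvg_cst|exact: al2].
Qed.

Theorem martingale_series_cvg :
  {ae P, forall w, cvgn (series (fun k => al k * zeta k w))}.
Proof.
(* On [bad j] the sums started at any time m reach 1/(j+1), an event of probability at most a
   constant times [tail m]. Off all [bad j] the series is Cauchy. *)
pose bad j := \bigcap_m exceed m (j.+1%:R^-1).
have mexc m e : measurable (exceed m e) by exact: bigcupT_measurable.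
have mbad j : measurable (bad j) by exact: bigcapT_measurable.
have bad0 j : P (bad j) = 0%E.
  apply/eqP; rewrite eq_le measure_ge0 andbT.
  have e0 : 0 < j.+1%:R^-1 :> R by [].
  have cv : (fun m => ((j.+1%:R^-1) ^- 2 * (K ^+ 2 * tail m))%:E) @ \oo --> 0%E.
    apply: cvg_EFin; first exact: nearW.
    rewrite (_ : 0 = (j.+1%:R^-1) ^- 2 * (K ^+ 2 * 0)); last by rewrite !mulr0.
    by apply: cvgMl_tmp; apply: cvgMl_tmp; exact: tail_cvg.
  rewrite -(cvg_lim _ cv)//; apply: lime_ge; first by apply/cvg_ex; eexists; exact: cv.
  apply: nearW => m; rewrite (le_trans _ (P_exceed m e0))// le_measure ?inE//.
  exact: bigcap_inf.
have : P.-negligible (\bigcup_j bad j).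
  apply: negligible_bigcup => j. exists (bad j); split; [exact: mbad|exact: bad0|by []].
apply: negligibleS => w /= nc; apply: contrapT => nbad; apply: nc.
apply: cvgn_cauchy => e e0.
have [j _ je] := cvgr_lt _ (@cvg_harmonic R) _ e0.
have {}je : j.+1%:R^-1 < e by exact: (je j (leqnn j)).
have [m Hm] : exists m, ~ exceed m (j.+1%:R^-1) w.
  by apply/existsNP => h; apply: nbad; exists j => // m _; exact: h.
exists m => n /subnKC <-; set i := (n - m)%N.
have lt : `|S m j.+1%:R^-1 i w| < j.+1%:R^-1.
  by rewrite ltNge; apply/negP => h; apply: Hm; exists i.
rewrite (le_trans _ (ltW je))// (le_trans _ (ltW lt))// below_level//.
by rewrite series_shift.
Qed.

End martingale.

(** * The filtration of the algorithm *)

Section algorithm.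
Context {R : realType} {d : nat} {dX : measure_display} {X : measurableType dX}.
Variables (lam : {finite_measure set X -> \bar R}) (pi : X -> R) (I : X -> 'I_d)
  (q : X -> X -> R).

Notation Th := ('I_d -> R).
Notation a := (mh_accept lam pi I q).
Notation mh_op := (mh_operator lam pi I q).
Variables (C m cq : R).
Hypothesis H : wl_setting lam pi I q C m cq.
Hypothesis d2 : (2 <= d)%N.

Context {dO : measure_display} {Omega : measurableType dO}.
Variables (P : probability Omega R) (Xn : nat -> Omega -> X)
  (th : nat -> Omega -> Th) (gam : nat -> R).

(** Generators of F_n, in the form in which the transition hypothesis of the theorem lists them. The
    later weights are functions of these data, by [weights_adapted]. *)
Definition history (n : nat) : set (set Omega) :=
  [set C | exists i, exists2 U : set R, measurable U & C = (fun w => th 0 w i) @^-1` U]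
  `|` [set C | exists k, exists2 U : set X, (k <= n)%N /\ measurable U & C = Xn k @^-1` U].

Hypothesis gam01 : forall n, 0 <= gam n.+1 < 1.
Hypothesis mX : forall n, measurable_fun setT (Xn n).
Hypothesis mth0 : forall i, measurable_fun setT (fun w => th 0 w i).
Hypothesis th0T : forall w, in_Theta (th 0 w).
Hypothesis thS : forall n w,
  th n.+1 w = fun i => th n w i + gam n.+1 * H_wl I (Xn n.+1 w) (th n w) i.

Lemma history_measurable n : history n `<=` measurable.
Proof.
move=> _ [[i [U mU ->]]|[k [U [_ mU] ->]]]; rewrite -[X in measurable X]setTI.
  exact: mth0.
exact: mX.
Qed.

Lemma history_mono n : history n `<=` history n.+1.
Proof.
move=> B [[i [U mU ->]]|[k [U [kn mU] ->]]]; first by left; exists i; exists U.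
by right; exists k; exists U => //; split=> //; exact: leqW.
Qed.

Notation G n := (g_sigma_algebraType (history n)).

Lemma state_adapted n : measurable_fun (setT : set (G n)) (Xn n : G n -> X).
Proof.
move=> _ U mU; rewrite setTI; apply: sub_sigma_algebra.
by right; exists n; exists U.
Qed.

Let stratum_sum (t : Th) x : \sum_i t i * \1_(part I i) x = t (I x).
Proof.
rewrite (bigD1 (I x))//= big1 => [|i iIx]; last first.
  by rewrite indicE memNset ?mulr0// => /= h; rewrite h eqxx in iIx.
by rewrite addr0 indicE mem_set// mulr1.
Qed.

Lemma weights_adapted n i : adapted history n (fun w => th n w i).
Proof.
elim: n i => [|n IH] i.
  move=> _ U mU; rewrite setTI; apply: sub_sigma_algebra.
  by left; exists i; exists U.
(* The weight at the random index I(X_(n+1)) is expanded as a finite sum over the strata, whose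
   measurability is clear. *)
rewrite (_ : (fun w => _) = (fun w => th n w i + gam n.+1 * (th n w i *
   (\1_(part I i) (Xn n.+1 w) - \sum_j th n w j * \1_(part I j) (Xn n.+1 w))))).
  have IHS j : adapted history n.+1 (fun w => th n w j).
    by apply: adaptedS => //; exact: history_mono.
  have m1 j : adapted history n.+1 (fun w => \1_(part I j) (Xn n.+1 w) : R).
    exact: (measurableT_comp (measurable_indic (wl_partition H j)) (@state_adapted n.+1)).
  apply: (measurable_funD (IHS i)); apply: measurable_funM; first exact: measurable_cst.
  apply: (measurable_funM (IHS i)); apply: (measurable_funB (m1 i)).
  by apply: measurable_sum => j; exact: (measurable_funM (IHS j) (m1 j)).
by apply/funext => w; rewrite thS stratum_sum.
Qed.

Lemma weights_close n w : in_Theta (th n w) ->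
  param_close (gam n.+1) (th n w) (th n.+1 w).
Proof.
move=> [th01 _] i; have /andP[g0 _] := gam01 n.
have /andP[t0 _] := th01 i; have /andP[s0 s1] := th01 (I (Xn n.+1 w)).
rewrite thS addrAC subrr add0r /H_wl normrM (ger0_norm g0) ler_wpM2l//.
rewrite normrM (gtr0_norm t0) ler_piMr ?(ltW t0)// indicE.
by case: (_ \in _); rewrite /= ?mulr1n ?mulr0n ler_norml; apply/andP; split; lra.
Qed.

Lemma weights_Theta n w : in_Theta (th n w).
Proof.
elim: n => [|n IH]; first exact: th0T.
have tc := weights_close IH; have [th01 th1] := IH.
have /andP[g0 g1] := gam01 n.
have pos i : 0 < th n.+1 w i.
  have /andP[t0 _] := th01 i.
  have := tc i; rewrite ler_norml => /andP[h _].
  by have : 0 < (1 - gam n.+1) * th n w i; [rewrite mulr_gt0// subr_gt0|lra].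
have sum1 : \sum_i th n.+1 w i = 1.
  rewrite thS big_split/= th1 -mulr_sumr.
  under [X in _ + _ * X]eq_bigr do rewrite /H_wl mulrBr.
  by rewrite sumrB -mulr_suml th1 mul1r stratum_sum subrr mulr0 addr0.
exact: in_Theta_pos.
Qed.

Section tower.
Variable n : nat.

Hypothesis transition : forall (A : set X) (B : set Omega), measurable A ->
  <<s history n >> B ->
  P (B `&` (Xn n.+1 @^-1` A)) =
  (\int[P]_(w in B) mh_kernel lam pi I q (th n w) (Xn n w) A)%E.

Notation T := (G n * X)%type.
(** The candidate for the conditional expectation of phi(w, X_(n+1)) given F_n. The first factor of
    [T] carries the sigma-algebra of the past, so [phi] may depend on all of it. *)
Let Q (phi : T -> R) (w : Omega) : R := mh_op (th n w) (fun y => phi (w, y)) (Xn n w).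

Let mfix (phi : T -> R) w : measurable_fun setT phi ->
  measurable_fun setT (fun y => phi (w, y)).
Proof.
by move=> mphi; exact: (measurableT_comp mphi (pair1_measurable (w : G n))).
Qed.

Let maw : measurable_fun setT (fun z : T => a (th n z.1) (Xn n z.1) z.2).
Proof.
have h := measurable_mh_accept H (T := G n) (@weights_adapted n) (@weights_Theta n).
apply: (measurableT_comp h (g := fun z : T => ((z.1, Xn n z.1), z.2))).
apply: measurable_fun_pair => //; apply: measurable_fun_pair => //.
exact: (measurableT_comp (@state_adapted n)).
Qed.

Let mQ (phi : T -> R) : measurable_fun setT phi -> adapted history n (Q phi).
Proof.
move=> mphi; apply: measurable_funD.
  apply: (measurable_Rintegral lam
    (h := fun z : T => a (th n z.1) (Xn n z.1) z.2 * phi z)).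
  exact: measurable_funM.
apply: measurable_funM.
  apply: (measurableT_comp mphi (g := fun w : G n => (w, Xn n w))).
  by apply: measurable_fun_pair => //; exact: state_adapted.
apply: measurable_funB => //.
exact: (measurable_Rintegral lam (h := fun z : T => a (th n z.1) (Xn n z.1) z.2)).
Qed.

Let QM (phi : T -> R) M w : measurable_fun setT phi -> (forall z, `|phi z| <= M) ->
  `|Q phi w| <= M.
Proof.
move=> mphi phiM; apply: (normr_mh_op H) => //; first exact: weights_Theta.
exact: mfix.
Qed.

Let iQ (phi : T -> R) : bounded_measurable phi -> P.-integrable setT (EFin \o Q phi).
Proof.
move=> [mphi [M phiM]]; apply: (integrable_bounded P (M := M)).
  by apply: (adapted_measurable history_measurable); exact: mQ.
by move=> w; exact: QM.
Qed.

Let mnext (phi : T -> R) : measurable_fun setT phi ->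
  measurable_fun setT (fun w => phi (w, Xn n.+1 w)).
Proof.
move=> mphi; pose phi' : G n * X -> R := phi.
apply: (measurableT_comp (f := phi) mphi (g := fun w : Omega => (w : G n, Xn n.+1 w))).
apply: measurable_fun_pair => //.
move=> _ U mU; rewrite setTI; apply: smallest_sub mU.
  exact: sigma_algebra_measurable.
exact: history_measurable.
Qed.

Let inext (phi : T -> R) : bounded_measurable phi ->
  P.-integrable setT (EFin \o (fun w => phi (w, Xn n.+1 w))).
Proof.
move=> [mphi [M phiM]]; apply: (integrable_bounded P (M := M)) => //.
exact: mnext.
Qed.

Let QD (f g : T -> R) w : bounded_measurable f -> bounded_measurable g ->
  Q (fun z => f z + g z) w = Q f w + Q g w.
Proof.
move=> [mf [M fM]] [mg [N gN]].
have i1 := integrable_accept_mul H (mfix w mf) (fun y => fM (w, y)) (Xn n w) (weights_Theta n w).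
have i2 := integrable_accept_mul H (mfix w mg) (fun y => gN (w, y)) (Xn n w) (weights_Theta n w).
have e : \int[lam]_y (a (th n w) (Xn n w) y * (f (w, y) + g (w, y))) =
   \int[lam]_y (a (th n w) (Xn n w) y * f (w, y)) +
   \int[lam]_y (a (th n w) (Xn n w) y * g (w, y)).
  by rewrite -RintegralD//; apply: eq_Rintegral => y _; rewrite mulrDr.
by rewrite /Q /mh_operator e; ring.
Qed.

Let QZ (c : R) (f : T -> R) w : bounded_measurable f -> Q (fun z => c * f z) w = c * Q f w.
Proof.
move=> [mf [M fM]].
have i1 := integrable_accept_mul H (mfix w mf) (fun y => fM (w, y)) (Xn n w) (weights_Theta n w).
have e : \int[lam]_y (a (th n w) (Xn n w) y * (c * f (w, y))) =
   c * \int[lam]_y (a (th n w) (Xn n w) y * f (w, y)).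
  by rewrite -RintegralZl//; apply: eq_Rintegral => y _; rewrite mulrCA.
by rewrite /Q /mh_operator e; ring.
Qed.

Let Qcvg (f_ : nat -> T -> R) (f : T -> R) M w :
  (forall k, measurable_fun setT (f_ k)) -> (forall k z, `|f_ k z| <= M) ->
  (forall z, f_ ^~ z @ \oo --> f z) -> (fun k => Q (f_ k) w) @ \oo --> Q f w.
Proof.
move=> mf fM ff; rewrite /Q /mh_operator.
apply: cvgD; last by apply: cvgMr_tmp; exact: ff.
apply: (cvg_Rintegral (g := fun y => M * q (Xn n w) y)).
- move=> k; apply: measurable_funM; last exact: mfix.
  by apply: (measurable_accept H); exact: weights_Theta.
- by move=> y; apply: cvgMl_tmp; exact: ff.
- exact: (integrableZl measurableT M (integrable_proposal H (Xn n w))).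
- move=> k y; rewrite normrM mulrC ler_pM//.
  rewrite ger0_norm ?(mh_accept_le H)// (mh_accept_ge0 H)//.
  exact: weights_Theta.
Qed.

Let Q_indic (B : set Omega) (A : set X) w : measurable A ->
  ((Q (\1_(B `*` A)) w)%:E =
   (\1_B w)%:E * mh_kernel lam pi I q (th n w) (Xn n w) A)%E.
Proof.
move=> mA.
have tT := weights_Theta n w.
have ia := integrable_accept H (Xn n w) tT.
have iaA : lam.-integrable A (EFin \o a (th n w) (Xn n w)).
  exact: (integrableS measurableT).
rewrite /mh_kernel.
rewrite -[(\int[lam]_(y in A) _)%E]fineK; last exact: integrable_fin_num.
rewrite -[(\int[lam]_y _)%E]fineK; last exact: integrable_fin_num.
rewrite -EFinB -!EFinM; congr (_%:E).
rewrite /Q /mh_operator -/(\int[lam]_(y in A) a (th n w) (Xn n w) y)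
  -/(\int[lam]_y a (th n w) (Xn n w) y).
have e y : \1_(B `*` A) (w, y) = \1_B w * \1_A y :> R.
  by rewrite !indicE in_setX/=; case: (w \in B); rewrite ?mul1r ?mul0r.
have ip : lam.-integrable setT (EFin \o (a (th n w) (Xn n w) \_ A)).
  by rewrite -restrict_EFin; apply/(integrable_mkcond _ mA).
have e2 : \int[lam]_y (a (th n w) (Xn n w) y * \1_(B `*` A) (w, y)) =
    \1_B w * \int[lam]_(y in A) a (th n w) (Xn n w) y.
  rewrite [in RHS]Rintegral_mkcond -RintegralZl//; apply: eq_Rintegral => y _.
  rewrite e mulrCA; congr (_ * _); rewrite /patch indicE.
  by case: ifPn => _; rewrite ?mulr1 ?mulr0.
by rewrite e2 e; ring.
Qed.

(** On indicators of rectangles this is the transition hypothesis; the monotone class theorem,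
    applied to the difference of the two sides, does the rest. *)
Lemma tower (phi : T -> R) : bounded_measurable phi ->
  \int[P]_w phi (w, Xn n.+1 w) =
  \int[P]_w mh_op (th n w) (fun y => phi (w, y)) (Xn n w).
Proof.
move=> bphi; apply/eqP; rewrite -subr_eq0; apply/eqP.
pose L (phi : T -> R) := \int[P]_w phi (w, Xn n.+1 w) - \int[P]_w Q phi w.
suff : L phi = 0 by [].
apply: functional_monotone_class bphi.
- move=> f g bf bg; rewrite /L.
  under [in X in _ - X]eq_Rintegral do rewrite QD//.
  rewrite RintegralD; [|by []|exact: inext|exact: inext].
  by rewrite RintegralD; [ring|by []|exact: iQ|exact: iQ].
- move=> c f bf; rewrite /L.
  under [in X in _ - X]eq_Rintegral do rewrite QZ//.
  rewrite RintegralZl; [|by []|exact: inext].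
  by rewrite RintegralZl; [ring|by []|exact: iQ].
- move=> f_ f M mf fM ff Lf.
  have mff : measurable_fun setT f.
    by apply: (measurable_fun_cvg mf) => z _; exact: ff.
  have c : (fun k => L (f_ k)) @ \oo --> L f.
    apply: cvgB; apply: (cvg_Rintegral (g := fun=> M)) => //.
    + by move=> k; exact: mnext.
    + exact: finite_measure_integrable_cst.
    + by move=> k; apply: (adapted_measurable history_measurable); exact: mQ.
    + by move=> w; exact: (Qcvg _ fM).
    + exact: finite_measure_integrable_cst.
    + by move=> k w; exact: QM.
  rewrite -(cvg_lim _ c)//; apply/cvg_lim => //.
  by under eq_fun do rewrite Lf; exact: cvg_cst.
- move=> B A mB mA; rewrite /L; apply/eqP; rewrite subr_eq0; apply/eqP.
  have mBO : measurable (B : set Omega).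
    apply: smallest_sub mB; first exact: sigma_algebra_measurable.
    exact: history_measurable.
  rewrite /Rintegral; congr fine.
  under [in RHS]eq_integral do rewrite Q_indic//.
  have := transition mA mB.
  rewrite [in X in _ = X -> _]integral_mkcond => tr.
  transitivity (P (B `&` Xn n.+1 @^-1` A)).
    rewrite -[in RHS](setIT (B `&` _)) -integral_indic//. 
    by apply: measurableI => //; rewrite -[X in measurable X]setTI; exact: mX.
  rewrite tr; apply: eq_integral => w _; rewrite /patch indicE.
  by case: ifPn => _; rewrite ?mul1e ?mul0e.
Qed.

End tower.
End algorithm.

(** * Deterministic limit theorems *)

Section series.
Context {R : realType}.

Lemma cvg_series_bounded_ge0 (u : nat -> R) B : (forall n, 0 <= u n) ->
  (forall n, series u n <= B) -> cvgn (series u).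
Proof.
move=> u0 uB; apply: nondecreasing_is_cvgn.
  by apply: nondecreasing_series => n _ _; exact: u0.
by exists B => _ [n _ <-]; exact: uB.
Qed.

Lemma cvg_series_dominated (u v : nat -> R) : (forall n, `|u n| <= v n) ->
  cvgn (series v) -> cvgn (series u).
Proof.
move=> uv cv; apply: normed_cvg; apply: series_le_cvg cv => // n.
  exact: normr_ge0.
exact: le_trans (normr_ge0 _) (uv n).
Qed.

Lemma cvgn_abs_bounded (u : nat -> R) : cvgn u -> exists B, forall n, `|u n| <= B.
Proof. by move=> /cvg_has_ub [B uB]; exists B => n; apply: uB; exists n. Qed.

Lemma kronecker (x : nat -> R) :
  cvgn (series (fun k => k.+1%:R^-1 * x k)) ->
  (fun n => n%:R^-1 * \sum_(k < n) x k) @ \oo --> 0.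
Proof.
set s := series _ => cs; have : s @ \oo --> limn s by [].
set l := limn s => sl.
(* Summation by parts: after division by n, what is left is [s] minus its own Cesaro mean, and both
   have limit [l]. *)
have E n : \sum_(k < n) x k = n%:R * s n - series s n.
  elim: n => [|n IH]; first by rewrite big_ord0 /series/= big_geq// mul0r subrr.
  rewrite big_ord_recr IH {3}/s !seriesSr -/s -natr1/=.
  by field; rewrite natr1.
have : (fun n => s n.+1 - arithmetic_mean s n) @ \oo --> l - l.
  by apply: cvgB; [rewrite cvg_shiftS|exact: cesaro].
rewrite subrr => h; rewrite -cvg_shiftS; apply: cvg_trans h; apply: near_eq_cvg.
apply: nearW => n /=; rewrite E /arithmetic_mean/= mulrBr mulrA mulVf ?mul1r//.
Qed.

(** Abel summation: the boundary term vanishes with [al], and the decrements of [al] have total at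
    most [al 0]. *)
Lemma telescoping_series_cvg (al U : nat -> R) M :
  (forall k, 0 <= al k) -> (forall k, al k.+1 <= al k) -> al @ \oo --> 0 ->
  (forall k, `|U k| <= M) -> cvgn (series (fun k => al k * (U k - U k.+1))).
Proof.
move=> al0 alS alcvg UM.
have M0 : 0 <= M := le_trans (normr_ge0 _) (UM 0%N).
have -> : series (fun k => al k * (U k - U k.+1)) =
    (fun n => al 0%N * U 0%N - al n * U n) \+ series (fun k => (al k.+1 - al k) * U k.+1).
  apply/funext; elim=> [|n IH] /=.
    by rewrite /series/= !big_geq// subrr addr0.
  by rewrite !seriesSr IH/=; ring.
have c1 : (fun n => al n * U n) @ \oo --> 0.
  apply: norm_cvg0; apply: (@squeeze_cvgr _ _ _ _ (fun=> 0) (fun k => al k * M)).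
  - apply: nearW => k; apply/andP; split; first exact: normr_ge0.
    by rewrite normrM (ger0_norm (al0 k)); apply: ler_wpM2l.
  - exact: cvg_cst.
  - by rewrite -(mul0r M); apply: cvgMr_tmp.
apply: is_cvgD; first by apply: is_cvgB; [exact: is_cvg_cst|apply/cvg_ex; exists 0].
apply: (@cvg_series_dominated _ (fun k => (al k - al k.+1) * M)).
  move=> k; have h : 0 <= al k - al k.+1 by rewrite subr_ge0.
  by rewrite normrM distrC (ger0_norm h); apply: ler_wpM2l.
apply: (@cvg_series_bounded_ge0 _ (al 0%N * M)).
  by move=> k; rewrite mulr_ge0// subr_ge0.
move=> n; suff -> : series (fun k => (al k - al k.+1) * M) n = (al 0%N - al n) * M.
  by rewrite ler_wpM2r// gerBl.
elim: n => [|n IH]; first by rewrite /series/= big_geq// subrr mul0r.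
by rewrite seriesSr IH; ring.
Qed.

End series.

(** * Convergence of the weights along a single trajectory *)

Section stochastic_approximation.
Context {R : realType} {d : nat}.
Variables (ts : 'I_d -> R) (m g1 : R) (gam : nat -> R) (th : nat -> 'I_d -> R)
  (ix : nat -> 'I_d).
Hypotheses (m0 : 0 < m) (tsm : forall i, m <= ts i) (ts1 : \sum_i ts i = 1).
Hypotheses (gam01 : forall k, 0 <= gam k <= g1) (g11 : g1 < 1).
Hypothesis thT : forall k, in_Theta (th k).
(** Here [gam k] stands for the step gamma_(k+1) and [ix k] for the stratum of X_(k+1). *)
Hypothesis thS : forall k i,
  th k.+1 i = th k i * (1 + gam k * ((i == ix k)%:R - th k (ix k))).
Hypothesis gam_sum : ~ cvgn (series gam).
Hypothesis gam_sqr : cvgn (series (fun k => gam k ^+ 2)).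

(** A chi-square distance over the normalizing sum: minus the mean of th(I) - theta_star(I) under
    pi_theta. So [drift_cvg] is a centred series. *)
Let D k := (\sum_i ts i ^+ 2 / th k i - 1) / (\sum_i ts i / th k i).
Hypothesis drift_cvg :
  cvgn (series (fun k => gam k * (th k (ix k) - ts (ix k) + D k))).

Let ts0 i : 0 < ts i. Proof. exact: lt_le_trans (tsm i). Qed.
Let th0 k i : 0 < th k i. Proof. by case: (thT k) => h _; case/andP: (h i). Qed.
Let th1 k i : th k i <= 1. Proof. by case: (thT k) => h _; case/andP: (h i) => _ /ltW. Qed.
Let sth k : \sum_i th k i = 1. Proof. by case: (thT k). Qed.
Let k0 : 0 < 1 - g1. Proof. by rewrite subr_gt0. Qed.

Let ln_bounds (x : R) : - g1 <= x ->
  x - x ^+ 2 / (1 - g1) <= ln (1 + x) <= x.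
Proof.
move=> gx; have x0 : 0 < 1 + x by move: k0; lra.
apply/andP; split; last by apply: le_ln1Dx; lra.
(* The lower bound is the upper bound at the inverse of 1 + x, which [g1] keeps bounded. *)
have h : ln (1 + x)^-1 <= (1 + x)^-1 - 1.
  rewrite -{1}[(1 + x)^-1](addrNK 1) addrC; apply: le_ln1Dx.
  by rewrite ltrBrDr addNr invr_gt0.
rewrite lnV ?posrE// in h.
have e : (1 + x)^-1 - 1 = - x + x ^+ 2 / (1 + x) by field; rewrite gt_eqF.
have : x ^+ 2 / (1 + x) <= x ^+ 2 / (1 - g1).
  by rewrite ler_wpM2l ?sqr_ge0// lef_pV2 ?posrE//; lra.
by lra.
Qed.

(* Up to a constant, the Kullback-Leibler divergence of th k from ts. *)
Let V k := - \sum_i ts i * ln (th k i).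
Let e k := V k.+1 - V k - gam k * (th k (ix k) - ts (ix k)).

Let V_ge0 k : 0 <= V k.
Proof.
rewrite oppr_ge0; apply: sumr_le0 => i _; rewrite mulr_ge0_le0 ?(ltW (ts0 i))//.
by apply: ln_le0.
Qed.

Let e_bounds k : 0 <= e k <= gam k ^+ 2 / (1 - g1).
Proof.
have /andP[g0 gg] := gam01 k.
pose u i := (i == ix k)%:R - th k (ix k) : R.
have u1 i : - 1 <= u i <= 1.
  have := th0 k (ix k); have := th1 k (ix k); rewrite /u.
  by case: (i == ix k) => /= h1 h2; rewrite ?mulr1n ?mulr0n; apply/andP; split; lra.
have gu i : - g1 <= gam k * u i by have /andP[] := u1 i; nra.
have dV : V k.+1 - V k = - \sum_i ts i * ln (1 + gam k * u i).
  rewrite /V opprK addrC -sumrB -sumrN; apply: eq_bigr => i _.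
  rewrite thS lnM ?posrE//; first by rewrite -/(u i); ring.
  by have := gu i; rewrite -/(u i); move: k0; lra.
have su : \sum_i ts i * u i = ts (ix k) - th k (ix k).
  under eq_bigr do rewrite /u mulrBr.
  rewrite sumrB -mulr_suml ts1 mul1r; congr (_ - _).
  rewrite (bigD1 (ix k))//= eqxx mulr1 big1 ?addr0// => i /negbTE ->.
  by rewrite mulr0.
have eE : e k = \sum_i ts i * (gam k * u i - ln (1 + gam k * u i)).
  rewrite /e dV; under [in RHS]eq_bigr do rewrite mulrBr.
  rewrite sumrB; under [X in _ = X - _]eq_bigr do rewrite mulrCA.
  by rewrite -mulr_sumr su; ring.
rewrite eE; apply/andP; split.
  apply: sumr_ge0 => i _; rewrite mulr_ge0 ?(ltW (ts0 i))// subr_ge0.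
  by have /andP[] := ln_bounds (gu i).
have -> : gam k ^+ 2 / (1 - g1) = \sum_i ts i * (gam k ^+ 2 / (1 - g1)).
  by rewrite -mulr_suml ts1 mul1r.
apply: ler_sum => i _.
rewrite ler_pM2l//.
have /andP[h _] := ln_bounds (gu i).
have : (gam k * u i) ^+ 2 / (1 - g1) <= gam k ^+ 2 / (1 - g1).
  rewrite ler_pM2r ?invr_gt0// exprMn ler_piMr ?sqr_ge0//.
  by have /andP[] := u1 i; nra.
by lra.
Qed.

Let e_cvg : cvgn (series e).
Proof.
apply: (@cvg_series_dominated _ _ (fun k => (1 - g1)^-1 * gam k ^+ 2)).
  by move=> k; have /andP[e0 e1] := e_bounds k; rewrite ger0_norm// mulrC.
rewrite (_ : series _ = (1 - g1)^-1 *: series (fun k => gam k ^+ 2)).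
  exact: is_cvgZr.
by apply/funext => n; rewrite /series/= -mulr_sumr.
Qed.

Let Z0 k : 0 < \sum_i ts i / th k i.
Proof.
apply: (@lt_le_trans _ _ (\sum_i ts i)); first by rewrite ts1.
by apply: ler_sum => i _; rewrite ler_pdivlMr// ler_piMr// ltW.
Qed.

Let Q k := \sum_i (th k i - ts i) ^+ 2.

Let chi2E k : \sum_i ts i ^+ 2 / th k i - 1 = \sum_i (th k i - ts i) ^+ 2 / th k i.
Proof.
have -> : \sum_i (th k i - ts i) ^+ 2 / th k i =
    \sum_i (ts i ^+ 2 / th k i + (th k i - 2 * ts i)).
  by apply: eq_bigr => i _; field; rewrite gt_eqF.
rewrite big_split/= sumrB -mulr_sumr sth ts1; ring.
Qed.

Let chi2_ge k : Q k <= \sum_i ts i ^+ 2 / th k i - 1.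
Proof.
rewrite chi2E; apply: ler_sum => i _.
by rewrite ler_pdivlMr// ler_piMr// sqr_ge0.
Qed.

Let D_ge0 k : 0 <= D k.
Proof.
rewrite divr_ge0 ?(ltW (Z0 k))//; apply: le_trans (chi2_ge k).
by apply: sumr_ge0 => i _; exact: sqr_ge0.
Qed.

Let VD n : V n = V 0%N + series (fun k => gam k * (th k (ix k) - ts (ix k) + D k)) n
  + series e n - series (fun k => gam k * D k) n.
Proof.
elim: n => [|n IH]; first by rewrite /series/= !big_geq//; ring.
by rewrite !seriesSr -[LHS](subrK (V n)) {2}IH /e; ring.
Qed.

(** Since [V] is nonnegative, [VD] leaves the accumulated drift no room to exceed V(0) plus two
    bounded series. *)
Let D_cvg : cvgn (series (fun k => gam k * D k)).
Proof.
have [B1 HB1] := cvgn_abs_bounded drift_cvg.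
have [B2 HB2] := cvgn_abs_bounded e_cvg.
apply: (@cvg_series_bounded_ge0 _ _ (V 0%N + B1 + B2)).
  by move=> k; have /andP[g0 _] := gam01 k; rewrite mulr_ge0.
move=> n; have := VD n; have := V_ge0 n.
by have := ler_normlW (HB1 n); have := ler_normlW (HB2 n); lra.
Qed.

Let V_cvg : cvgn V.
Proof.
rewrite (funext VD).
exact: (is_cvgB (is_cvgD (is_cvgD (is_cvg_cst _) drift_cvg) e_cvg) D_cvg).
Qed.

Let V_bound : exists2 B, 0 <= B & forall k, V k <= B.
Proof.
have [B HB] := cvgn_abs_bounded V_cvg; exists B.
  exact: le_trans (normr_ge0 _) (HB 0%N).
by move=> k; exact: ler_normlW.
Qed.

(** All terms of [V] are nonnegative, so each [- ln (th k i)] is at most a bound of [V] divided by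
    [m]. *)
Let th_lower : exists2 eps, 0 < eps & forall k i, eps <= th k i.
Proof.
have [B B0 VB] := V_bound; exists (expR (- (B / m))); first exact: expR_gt0.
move=> k i; rewrite -[leRHS]lnK ?posrE// ler_expR lerNl.
have h : ts i * - ln (th k i) <= B.
  apply: le_trans (VB k); rewrite /V (bigD1 i)//= opprD mulrN lerDl.
  rewrite oppr_ge0; apply: sumr_le0 => j _; rewrite mulr_ge0_le0 ?(ltW (ts0 j))//.
  exact: ln_le0.
have l0 : 0 <= - ln (th k i) by rewrite oppr_ge0 ln_le0.
rewrite ler_pdivlMr// mulrC; apply: le_trans h.
exact: ler_wpM2r.
Qed.

Let Vs := - \sum_i ts i * ln (ts i).

Let V_upper k : V k - Vs <= \sum_i ts i ^+ 2 / th k i - 1.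
Proof.
rewrite -ts1 /V /Vs opprK addrC -!sumrB; apply: ler_sum => i _.
have h : ln (ts i / th k i) <= ts i / th k i - 1.
  rewrite -{1}[ts i / th k i](addrNK 1) addrC; apply: le_ln1Dx.
  by rewrite ltrBrDr addNr divr_gt0.
have := ler_wpM2l (ltW (ts0 i)) h.
rewrite ln_div ?posrE// !mulrBr mulr1 mulrA -expr2.
by [].
Qed.

(** The Kullback-Leibler divergence dominates the squared Hellinger distance, again by ln y <= y -
    1. The 4 bounds the square of the sum of two square roots, each at most 1. *)
Let V_lower k i : (th k i - ts i) ^+ 2 <= 4 * (V k - Vs).
Proof.
pose s j := Num.sqrt (th k j); pose t j := Num.sqrt (ts j).
have sE j : s j ^+ 2 = th k j by rewrite sqr_sqrtr// ltW.
have tE j : t j ^+ 2 = ts j by rewrite sqr_sqrtr// ltW.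
have s0 j : 0 < s j by rewrite sqrtr_gt0.
have t0 j : 0 < t j by rewrite sqrtr_gt0.
have ts_le1 j : ts j <= 1.
  rewrite -ts1 (bigD1 j)//= lerDl; apply: sumr_ge0 => l _; exact: ltW.
have s1 j : s j <= 1 by rewrite -sqrtr1 ler_wsqrtr.
have t1 j : t j <= 1 by rewrite -sqrtr1 ler_wsqrtr.
have h : \sum_j (s j - t j) ^+ 2 <= V k - Vs.
  have -> : \sum_j (s j - t j) ^+ 2 = \sum_j (2 * (t j ^+ 2 - s j * t j)).
    have e0 : \sum_j (th k j - ts j) = 0 by rewrite sumrB sth ts1 subrr.
    transitivity (\sum_j (2 * (t j ^+ 2 - s j * t j)) + \sum_j (th k j - ts j)).
      rewrite -big_split/=; apply: eq_bigr => j _.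
      by rewrite -[in RHS]sE -[in RHS]tE; ring.
    by rewrite e0 addr0.
  rewrite /V /Vs opprK addrC -!sumrB; apply: ler_sum => j _.
  have h : ln (s j / t j) <= s j / t j - 1.
    rewrite -{1}[s j / t j](addrNK 1) addrC; apply: le_ln1Dx.
    by rewrite ltrBrDr addNr divr_gt0.
  rewrite ln_div ?posrE// in h.
  have lnts : ln (ts j) = 2 * ln (t j) by rewrite -tE expr2 lnM ?posrE//; ring.
  have lnth : ln (th k j) = 2 * ln (s j) by rewrite -sE expr2 lnM ?posrE//; ring.
  rewrite lnts lnth -tE.
  have := ler_wpM2l (sqr_ge0 (t j)) h.
  have -> : t j ^+ 2 * (s j / t j - 1) = s j * t j - t j ^+ 2 by field; rewrite gt_eqF.
  by lra.
have hi : (s i - t i) ^+ 2 <= V k - Vs.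
  by apply: le_trans h; rewrite (bigD1 i)//= lerDl; apply: sumr_ge0 => j _; exact: sqr_ge0.
apply: le_trans (ler_wpM2l _ hi) => //.
rewrite -sE -tE subr_sqr exprMn mulrC ler_wpM2r ?sqr_ge0//.
have -> : 4 = 2 ^+ 2 :> R by ring.
rewrite ler_sqr ?nnegrE//; last by rewrite addr_ge0// ltW.
by have := s1 i; have := t1 i; lra.
Qed.

Theorem stochastic_approximation_cvg i : th ^~ i @ \oo --> ts i.
Proof.
have [eps eps0 th_eps] := th_lower.
have vV : V @ \oo --> limn V by [].
set v := limn V in vV.
have Zeps k : \sum_i ts i / th k i <= eps^-1.
  rewrite -[leRHS]mul1r -ts1 mulr_suml; apply: ler_sum => j _.
  by rewrite ler_pM2l// lef_pV2 ?posrE.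
have D_lower k : eps * (V k - Vs) <= D k.
  rewrite /D ler_pdivlMr// mulrAC.
  have c0 : 0 <= \sum_i ts i ^+ 2 / th k i - 1.
    by apply: le_trans (chi2_ge k); apply: sumr_ge0 => j _; exact: sqr_ge0.
  have z1 : eps * (\sum_i ts i / th k i) <= 1.
    by rewrite -(mulfV (lt0r_neq0 eps0)) ler_pM2l.
  have z0 : 0 <= eps * (\sum_i ts i / th k i) by rewrite mulr_ge0// ltW.
  apply: (@le_trans _ _ (eps * (\sum_i ts i / th k i) * (\sum_i ts i ^+ 2 / th k i - 1))).
    exact: ler_wpM2l.
  by rewrite ler_piMl.
have Vs_le k : Vs <= V k.
  by have := V_lower k i; have := sqr_ge0 (th k i - ts i); lra.
(* If the limit exceeded [Vs], [D] would eventually stay above [eps * del], and [D_cvg] would make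
   [gam] summable. *)
have vVs : v <= Vs.
  rewrite leNgt; apply/negP => Vsv; apply: gam_sum.
  pose del := (v - Vs) / 2; have del0 : 0 < del by rewrite divr_gt0// subr_gt0.
  have [N _ hN] : \forall k \near \oo, Vs + del < V k.
    by apply: (cvgr_gt _ vV); rewrite /del; lra.
  pose c := (eps * del)^-1.
  have ed0 : 0 < eps * del by rewrite mulr_gt0.
  have [B HB] := cvgn_abs_bounded D_cvg.
  have [N0 HN0] : exists B', forall k, (k < N)%N -> gam k <= B'.
    by exists 1 => k _; have /andP[_ /le_trans -> //] := gam01 k; exact: ltW.
  apply: (@cvg_series_bounded_ge0 _ _ (N%:R + c * B)).
    by move=> k; have /andP[] := gam01 k.
  (* The indicator pays for the first N terms, where only gam k <= 1 is known. *)
  move=> n; have gk k : gam k <= (k < N)%:R + c * (gam k * D k).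
    have /andP[g0 gg] := gam01 k.
    case: ltnP => [kN|Nk].
      have : 0 <= c * (gam k * D k) by rewrite mulr_ge0 ?invr_ge0 ?(ltW ed0)// mulr_ge0.
      by move: k0; rewrite mulr1n; lra.
    rewrite mulr0n add0r mulrC -ler_pdivrMr ?invr_gt0// invrK ler_wpM2l//.
    apply: le_trans (D_lower k); rewrite ler_pM2l//.
    by have := hN k Nk; lra.
  apply: (@le_trans _ _ (\sum_(k < n) ((k < N)%:R + c * (gam k * D k)))).
    by rewrite /series/= big_mkord; apply: ler_sum => k _; exact: gk.
  rewrite big_split/= -mulr_sumr lerD//.
    rewrite -natr_sum ler_nat; suff : (\sum_(k < n) (k < N) <= minn n N)%N.
      by move=> /leq_trans; apply; exact: geq_minr.
    elim: n => [|n IH]; first by rewrite big_ord0.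
    rewrite big_ord_recr/=; have [h|h] := ltnP n N.
      by rewrite addn1 (minn_idPl h) ltnS; rewrite (minn_idPl (ltnW h)) in IH.
    by rewrite addn0 (minn_idPr (leqW h)); rewrite (minn_idPr h) in IH.
  rewrite ler_wpM2l ?invr_ge0 ?(ltW ed0)//.
  apply: le_trans (ler_normlW (HB n)).
  by rewrite /series/= big_mkord.
have cV : (fun k => 4 * (V k - Vs)) @ \oo --> 0.
  have Vsv : v = Vs.
    apply/eqP; rewrite eq_le vVs/=; apply: limr_ge => //.
    by apply: nearW => k; exact: Vs_le.
  rewrite -(mulr0 4) -(subrr v) {2}Vsv.
  by apply: cvgMl_tmp; apply: cvgB => //; exact: cvg_cst.
apply/cvgrPdist_lt => e0 e00.
have [N _ hN] := cvgr_lt _ cV _ (exprn_gt0 2 e00).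
exists N => // k /= Nk; rewrite distrC.
rewrite -(@ltr_pXn2r _ 2) ?nnegrE ?(ltW e00)// real_normK ?num_real//.
exact: le_lt_trans (V_lower k i) (hN k Nk).
Qed.

End stochastic_approximation.

(** * Convergence of the algorithm *)

Lemma cvg_cesaro {R : realType} (u : nat -> R) (l : R) : u @ \oo --> l ->
  (fun n => n%:R^-1 * \sum_(k < n) u k) @ \oo --> l.
Proof.
move=> /cesaro h; rewrite -cvg_shiftS; apply: cvg_trans h; apply: near_eq_cvg.
by apply: nearW => n /=; rewrite /arithmetic_mean/= /series/= big_mkord.
Qed.

Section convergence.
Context {R : realType} {d : nat} {dX : measure_display} {X : measurableType dX}.
Variables (lam : {finite_measure set X -> \bar R}) (pi : X -> R) (I : X -> 'I_d)
  (q : X -> X -> R).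

Notation Th := ('I_d -> R).
Notation ts := (theta_star lam pi I).
Notation mh_op := (mh_operator lam pi I q).
Notation pi_op := (pi_operator lam pi I).
Variables (C m cq : R).
Hypothesis H : wl_setting lam pi I q C m cq.
Hypothesis d2 : (2 <= d)%N.
Notation rho := (doeblin_cst C m cq).

Context {dO : measure_display} {Omega : measurableType dO}.
Variables (P : probability Omega R) (Xn : nat -> Omega -> X)
  (th : nat -> Omega -> Th) (gam : nat -> R) (g1 : R).

Hypothesis gam01 : forall n, 0 <= gam n.+1 <= g1.
Hypothesis g11 : g1 < 1.
Hypothesis gam_cvg0 : gam @ \oo --> 0.
Hypothesis gam_noninc : forall n, gam n.+2 <= gam n.+1.
Hypothesis gam_sum : ~ cvgn (series (fun k => gam k.+1)).
Hypothesis gam_sqr : cvgn (series (fun k => gam k.+1 ^+ 2)).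
Hypothesis mX : forall n, measurable_fun setT (Xn n).
Hypothesis mth0 : forall i, measurable_fun setT (fun w => th 0 w i).
Hypothesis th0T : forall w, in_Theta (th 0 w).
Hypothesis thS : forall n w,
  th n.+1 w = fun i => th n w i + gam n.+1 * H_wl I (Xn n.+1 w) (th n w) i.
Hypothesis transition : forall n (A : set X) (B : set Omega), measurable A ->
  <<s history Xn th n >> B ->
  P (B `&` (Xn n.+1 @^-1` A)) =
  (\int[P]_(w in B) mh_kernel lam pi I q (th n w) (Xn n w) A)%E.

Let gam01' n : 0 <= gam n.+1 < 1.
Proof. by have /andP[-> /le_lt_trans -> //] := gam01 n. Qed.

Let thT n w : in_Theta (th n w).
Proof. exact: (weights_Theta d2 gam01' th0T thS). Qed.

Let Th0 : exists t : Th, in_Theta t.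
Proof. by exists (th 0 point). Qed.

Let th_close n w : param_close (gam n.+1) (th n w) (th n.+1 w).
Proof. exact: (weights_close gam01' thS). Qed.

Let hm := history_measurable mX mth0.
Let hmono := @history_mono _ _ _ _ _ _ Xn th.
Let th_ad := weights_adapted H thS.
Let X_ad := @state_adapted _ _ _ _ _ _ Xn th.

Notation regular := (@regular_fun R d dX X g1).

Section weighted_series.
Variables (F : Th -> X -> R) (M L : R).
Hypothesis rF : regular F M L.

Notation G n := (g_sigma_algebraType (history Xn th n)).

Lemma regular_adapted_next n :
  adapted (history Xn th) n.+1 (fun w => F (th n w) (Xn n.+1 w)).
Proof.
have mth i : measurable_fun setT (fun w : G n.+1 => th n w i).
  exact: (adaptedS hmono (@th_ad n i)).
apply: (measurableT_comp (regular_measurable rF mth (thT n))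
  (g := fun w : G n.+1 => (w, Xn n.+1 w))).
by apply: measurable_fun_pair => //; exact: (@X_ad _).
Qed.

Lemma regular_adapted n : adapted (history Xn th) n (fun w => F (th n w) (Xn n w)).
Proof.
have mth i : measurable_fun setT (fun w : G n => th n w i) by exact: (@th_ad n i).
apply: (measurableT_comp (regular_measurable rF mth (thT n))
  (g := fun w : G n => (w, Xn n w))).
by apply: measurable_fun_pair => //; exact: (@X_ad _).
Qed.

Lemma tower_regular n (Y : Omega -> R) : adapted (history Xn th) n Y ->
  (exists B, forall w, `|Y w| <= B) ->
  \int[P]_w (Y w * F (th n w) (Xn n.+1 w)) =
  \int[P]_w (Y w * mh_op (th n w) (F (th n w)) (Xn n w)).
Proof.
move=> aY [B YB].
have mth i : measurable_fun setT (fun w : G n => th n w i) by exact: (@th_ad n i).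
have bphi : bounded_measurable (fun z : G n * X => Y z.1 * F (th n z.1) z.2).
  split.
    apply: measurable_funM; last exact: (regular_measurable rF mth (thT n)).
    exact: (measurableT_comp (f := Y : G n -> R) aY).
  exists (B * M) => z; rewrite normrM ler_pM//.
  exact: (regular_bounded rF).
rewrite (tower H d2 gam01' mX mth0 th0T thS (@transition n) bphi) /=.
apply: eq_Rintegral => w _.
have i1 := integrable_accept_mul H (regular_fix rF (thT n w))
  (fun y => regular_bounded rF y (thT n w)) (Xn n w) (thT n w).
have e : \int[lam]_y (mh_accept lam pi I q (th n w) (Xn n w) y * (Y w * F (th n w) y)) =
    Y w * \int[lam]_y (mh_accept lam pi I q (th n w) (Xn n w) y * F (th n w) y).
  rewrite -RintegralZl//; apply: eq_Rintegral => y _.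
  by rewrite mulrCA.
by rewrite /mh_operator e; ring.
Qed.

End weighted_series.

Lemma weighted_series_cvg (F : Th -> X -> R) M L (al : nat -> R) : regular F M L ->
  (forall k, 0 <= al k) -> (forall k, al k.+1 <= al k) -> al @ \oo --> 0 ->
  cvgn (series (fun k => al k ^+ 2)) -> cvgn (series (fun k => al k * gam k.+1)) ->
  {ae P, forall w, cvgn (series (fun k =>
    al k * (F (th k w) (Xn k.+1 w) - pi_op (th k w) (F (th k w)))))}.
Proof.
move=> rF al0 alS alc al2 alg.
pose Fp := poisson lam pi I q C m cq F.
have rP := regular_poisson H g11 Th0 rF; rewrite -/Fp in rP.
have rU := regular_mh_op H g11 Th0 rP.
set M' := _ / rho in rP rU; set L' := _ + _ in rU.
(* Adding [zeta], U_k - U_(k+1) and [r] restores both sides of the Poisson equation at X_(k+1). In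
   [r] the state is fixed and only the weights move, which costs a multiple of gamma_(k+1). *)
pose U k w := mh_op (th k w) (Fp (th k w)) (Xn k w).
pose zeta k w := Fp (th k w) (Xn k.+1 w) - U k w.
pose r k w := mh_op (th k.+1 w) (Fp (th k.+1 w)) (Xn k.+1 w)
  - mh_op (th k w) (Fp (th k w)) (Xn k.+1 w).
have aU k : adapted (history Xn th) k (U k) by exact: (regular_adapted rU).
have UM k w : `|U k w| <= M' by exact: (regular_bounded rU).
have aF k := regular_adapted_next rP k.
have FM k w : `|Fp (th k w) (Xn k.+1 w)| <= M' by exact: (regular_bounded rP).
have : {ae P, forall w, cvgn (series (fun k => al k * zeta k w))}.
  apply: (martingale_series_cvg hm hmono (K := M' + M') al2).
  - move=> k; apply: measurable_funB; first exact: aF.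
    exact: (adaptedS hmono (aU k)).
  - by move=> k w; rewrite (le_trans (ler_normB _ _))// lerD.
  - move=> k Y aY bY; have [B YB] := bY.
    have mY := adapted_measurable hm aY.
    have i1 : P.-integrable setT (EFin \o (fun w => Y w * Fp (th k w) (Xn k.+1 w))).
      apply: (integrable_bounded P (M := B * M')).
        by apply: measurable_funM => //; exact: (adapted_measurable hm (aF k)).
      by move=> w; rewrite normrM ler_pM.
    have i2 : P.-integrable setT (EFin \o (fun w => Y w * U k w)).
      apply: (integrable_bounded P (M := B * M')).
        by apply: measurable_funM => //; exact: (adapted_measurable hm (aU k)).
      by move=> w; rewrite normrM ler_pM.
    rewrite (_ : (fun w => _) =
      (fun w => Y w * Fp (th k w) (Xn k.+1 w) - Y w * U k w)); last first.
      by apply/funext => w; rewrite mulrBr.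
    by rewrite RintegralB// (tower_regular rP aY bY) subrr.
apply: filterS => w cz.
have ct : cvgn (series (fun k => al k * (U k w - U k.+1 w))).
  exact: (telescoping_series_cvg al0 alS alc (UM ^~ w)).
have cr : cvgn (series (fun k => al k * r k w)).
  apply: (@cvg_series_dominated _ _ (fun k => L' * (al k * gam k.+1))).
    move=> k; rewrite normrM (ger0_norm (al0 k)) mulrCA ler_wpM2l//.
    by rewrite distrC; exact: (regular_close rU).
  rewrite (_ : series _ = L' *: series (fun k => al k * gam k.+1)).
    exact: is_cvgZr.
  by apply/funext => n; rewrite /series/= -mulr_sumr.
rewrite (_ : series _ = series (fun k => al k * zeta k w) +
  series (fun k => al k * (U k w - U k.+1 w)) + series (fun k => al k * r k w)).
  exact: (is_cvgD (is_cvgD cz ct) cr).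
rewrite -!seriesD; congr (series _); apply/funext => k.
rewrite (poisson_equation H g11 Th0 rF _ (thT k w)) -/Fp.
transitivity (al k * zeta k w + al k * (U k w - U k.+1 w) + al k * r k w) => //.
by rewrite /zeta /r /U; ring.
Qed.

Let ts0 i : 0 < ts i. Proof. exact: lt_le_trans (wl_m0 H) (wl_ts H i). Qed.
Let ts_le1 i : ts i <= 1.
Proof.
rewrite -(theta_star_sum H) (bigD1 i)//= lerDl; apply: sumr_ge0 => j _.
exact: ltW.
Qed.

Let cvg_gamS : (fun k => gam k.+1) @ \oo --> 0.
Proof. by rewrite (cvg_shiftS gam). Qed.

Lemma weights_cvg : {ae P, forall w, forall i, (fun n => th n w i) @ \oo --> ts i}.
Proof.
pose F (t : Th) (x : X) := t (I x) - ts (I x).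
have rF : regular F 1 1.
  split.
  - apply: (param_measurable_stratum H (phi := fun t i => t i - ts i)) => i dT T t mt _.
    exact: measurable_funB.
  - move=> t x [t01 _]; have /andP[a0 a1] := t01 (I x).
    have := ts0 (I x); have := ts_le1 (I x); rewrite ler_norml /F => ? ?.
    by apply/andP; split; lra.
  - by [].
  - move=> g t t' x /andP[g0 _] [t01 _] _ tc; have /andP[a0 a1] := t01 (I x).
    rewrite /F opprB addrA subrK distrC mul1r.
    by rewrite (le_trans (tc _))// ler_piMr// ltW.
have FE t : in_Theta t -> pi_op t (F t) =
    - ((\sum_i ts i ^+ 2 / t i - 1) / (\sum_i ts i / t i)).
  move=> tT; have [t01 _] := tT; have t0 j : 0 < t j by case/andP: (t01 j).
  rewrite /F (pi_op_strata H (fun i => t i - ts i))// mulrC -mulNr opprB.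
  congr (_ * _); rewrite -(theta_star_sum H) -sumrB; apply: eq_bigr => i _.
  by field; rewrite gt_eqF.
have gam2 k : gam k.+1 * gam k.+1 = gam k.+1 ^+ 2 by [].
have := weighted_series_cvg rF (fun k => _) gam_noninc cvg_gamS gam_sqr _.
move=> /(_ (fun k => let: conj h _ := andP (gam01 k) in h)).
move=> /(_ gam_sqr); apply: filterS => w cw i.
apply: (@stochastic_approximation_cvg _ _ ts m g1 (fun k => gam k.+1) (fun n => th n w)
  (fun k => I (Xn k.+1 w)) (wl_m0 H) (wl_ts H) (theta_star_sum H) gam01 g11) => //.
- move=> k j; rewrite thS /H_wl indicE.
  rewrite (_ : (Xn k.+1 w \in part I j) = (j == I (Xn k.+1 w))); first by ring.
  by rewrite eq_sym; apply/idP/eqP => [/set_mem//|h]; exact/mem_set.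
- rewrite (_ : (fun k => _) = (fun k => gam k.+1 * (F (th k w) (Xn k.+1 w)
    - pi_op (th k w) (F (th k w)))))//.
  by apply/funext => k; rewrite FE// opprK.
Qed.

Lemma theta_star_Theta : in_Theta ts.
Proof. exact: (in_Theta_pos d2 ts0 (theta_star_sum H)). Qed.

Section bounded_test_function.
Variables (f : X -> R) (M : R).
Hypotheses (mf : measurable_fun setT f) (fM : forall x, `|f x| <= M).

Let M0 : 0 <= M. Proof. exact: le_trans (normr_ge0 _) (fM point). Qed.

Let rf : regular (fun _ => f) M 0.
Proof.
split=> //.
  by move=> dT T t _ _; exact: (measurableT_comp mf).
by move=> g t t' x _ _ _ _; rewrite subrr normr0 mul0r.
Qed.

(** As theta_star has positive coordinates, coordinatewise convergence to it is convergence in the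
    relative distance. *)
Lemma pi_op_cvg (t : nat -> Th) : (forall n, in_Theta (t n)) ->
  (forall i, t ^~ i @ \oo --> ts i) ->
  (fun n => pi_op (t n) f) @ \oo --> pi_op ts f.
Proof.
move=> tT tc; apply/cvgrPdist_le => e e0.
(* The value 1/2 replaces [g1] in this comparison, and the + 1 in [e / (K + 1)] covers K = 0. *)
pose K : R := 2 / (1 - 2^-1) * M.
have K0 : 0 <= K by rewrite /K mulr_ge0// divr_ge0//; lra.
pose g := Num.min (2^-1 : R) (e / (K + 1)).
have g0 : 0 < g by rewrite lt_min invr_gt0 ltr0n/= divr_gt0//; lra.
have gle : 0 <= g <= 2^-1 by rewrite ltW//= ge_min lexx.
have : \forall n \near \oo, forall i, `|ts i - t n i| <= g * ts i.
  apply: filter_forall => i; have gi : 0 < g * ts i by rewrite mulr_gt0.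
  by have /cvgrPdist_le/(_ _ gi) := tc i.
move=> [N _ hN]; exists N => // n /= Nn.
have h12 : (2^-1 : R) < 1 by rewrite invf_lt1// ltr1n.
have ct : param_close g ts (t n) by move=> i; rewrite distrC; exact: hN.
rewrite (le_trans (pi_op_close H h12 gle theta_star_Theta (tT n) ct mf fM))//.
rewrite -/K; have ge : g <= e / (K + 1) by rewrite ge_min lexx orbT.
apply: (@le_trans _ _ (K * (e / (K + 1)))); first exact: ler_wpM2l.
by rewrite mulrA ler_pdivrMr; [nra|lra].
Qed.

Let pi_cvg : {ae P, forall w, (fun n => pi_op (th n w) f) @ \oo --> pi_op ts f}.
Proof. by apply: filterS weights_cvg => w cw; exact: pi_op_cvg. Qed.

Let inv_sqr_cvg : cvgn (series (fun k => (k.+1%:R^-1 : R) ^+ 2)).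
Proof.
apply: (@cvg_series_bounded_ge0 _ _ 2) => [k|n]; first exact: sqr_ge0.
(* Inductive because 1/(x+1)^2 <= 1/x - 1/(x+1). *)
suff h : series (fun k => (k.+1%:R^-1 : R) ^+ 2) n.+1 <= 2 - n.+1%:R^-1.
  apply: le_trans (_ : _ <= series (fun k => (k.+1%:R^-1 : R) ^+ 2) n.+1) _.
    by rewrite seriesSr lerDl sqr_ge0.
  by rewrite (le_trans h)// gerBl.
elim: n => [|n IH].
  by rewrite /series/= big_nat1 invr1 expr1n; lra.
rewrite seriesSr; apply: le_trans (lerD IH (lexx _)) _.
have n0 : 0 < n.+1%:R :> R by [].
rewrite -[n.+2%:R]natr1; set x : R := n.+1%:R in n0 *.
have -> : 2 - x^-1 + (x + 1)^-1 ^+ 2 =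
    2 - (x + 1)^-1 - (x * (x + 1) ^+ 2)^-1.
  by field; rewrite !gt_eqF//; lra.
by rewrite gerBl invr_ge0 mulr_ge0 ?sqr_ge0// ltW.
Qed.

(** The centring pi_(theta_k)(f) moves with k; its averages converge by Cesaro, since theta_k tends
    to theta_star. *)
Lemma law_of_large_numbers : {ae P, forall w,
  (fun n => n%:R^-1 * \sum_(k < n) f (Xn k.+1 w)) @ \oo --> pi_op ts f}.
Proof.
have al0 k : 0 <= (k.+1%:R^-1 : R) by rewrite invr_ge0.
have alS k : (k.+2%:R^-1 : R) <= k.+1%:R^-1.
  by rewrite lef_pV2 ?posrE// ler_nat.
have alg : cvgn (series (fun k => (k.+1%:R^-1 : R) * gam k.+1)).
  apply: (@cvg_series_dominated _ _ (fun k => (k.+1%:R^-1) ^+ 2 + gam k.+1 ^+ 2)).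
    move=> k; have /andP[g0 _] := gam01 k; rewrite ger0_norm ?mulr_ge0//.
    set x := k.+1%:R^-1; set y := gam k.+1; have := sqr_ge0 (x - y).
    by have := sqr_ge0 x; have := sqr_ge0 y; nra.
  rewrite (_ : series _ = series (fun k => (k.+1%:R^-1) ^+ 2) +
    series (fun k => gam k.+1 ^+ 2)); last by rewrite -seriesD.
  exact: (is_cvgD inv_sqr_cvg gam_sqr).
have := weighted_series_cvg rf al0 alS (@cvg_harmonic R) inv_sqr_cvg alg.
apply: filterS2 pi_cvg => w cpi cw.
rewrite (_ : (fun n => _) = (fun n => n%:R^-1 *
    \sum_(k < n) (f (Xn k.+1 w) - pi_op (th k w) f) +
  n%:R^-1 * \sum_(k < n) pi_op (th k w) f)); last first.
  apply/funext => n; rewrite -mulrDr -big_split/=; congr (_ * _).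
  by apply: eq_bigr => k _; rewrite subrK.
have := cvgD (kronecker (x := fun k => f (Xn k.+1 w) - pi_op (th k w) f) cw) (cvg_cesaro cpi).
rewrite add0r => h; exact: h.
Qed.

(** R_t^k f, with the weights frozen at [t] throughout the iteration. *)
Let G := fix G k (t : Th) : X -> R :=
  if k is k'.+1 then residual_operator lam pi I q C m cq t (G k' t) else f.

Let rho0 := doeblin_cst_gt0 H.
Let rho1 : rho <= 1. Proof. exact: doeblin_cst_le1 H _ theta_star_Theta. Qed.

Let rG k : exists L, regular (G k) ((1 - rho) ^+ k * M) L.
Proof.
elim: k => [|k [L IH]]; first by exists 0; rewrite expr0 mul1r.
have := regular_residual_op H g11 Th0 IH; rewrite mulrA -exprS => h.
by eexists; exact: h.
Qed.

Let pi_G k t : in_Theta t -> pi_op t (G k t) = (1 - rho) ^+ k * pi_op t f.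
Proof.
move=> tT; elim: k => [|k IH]; first by rewrite expr0 mul1r.
have [L rk] := rG k.
by rewrite [G k.+1 t]/= (pi_op_residual H g11 Th0 rk tT) IH exprS mulrA.
Qed.

Let e k n := \int[P]_w G k (th n w) (Xn n.+1 w).
Let pn n := \int[P]_w pi_op (th n w) f.

Let mpn n : adapted (history Xn th) n (fun w => pi_op (th n w) f).
Proof.
have mth i : measurable_fun setT
    (fun w : g_sigma_algebraType (history Xn th n) => th n w i) by exact: (@th_ad n i).
apply: (measurableT_comp (param_measurable_pi_op H (regular_measurable rf) mth (thT n))
  (g := fun w : g_sigma_algebraType (history Xn th n) => (w, point))).
exact: measurable_fun_pair.
Qed.

Let pnM n w : `|pi_op (th n w) f| <= M.
Proof. exact: (normr_pi_op H mf fM). Qed.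

Let pn_cvg : pn @ \oo --> pi_op ts f.
Proof.
have -> : pi_op ts f = \int[P]_w (cst (pi_op ts f) w).
  rewrite Rintegral_cst// (_ : fine _ = 1) ?mulr1//.
  exact: (congr1 fine (@probability_setT _ _ _ P)).
apply: (cvg_Rintegral_ae (g := fun=> M)) => //.
- by move=> n; exact: (adapted_measurable hm (@mpn n)).
- exact: finite_measure_integrable_cst.
Qed.

(** Conditioning on F_(n+1) applies P = rho pi + R to R^k f at X_(n+1). Going back from theta_(n+1)
    to theta_n then costs [L * gam n.+1], with [L] depending on k but not on n. *)
Let e_step k : exists L, forall n,
  `|e k n.+1 - e k.+1 n - rho * (1 - rho) ^+ k * pn n.+1| <= L * gam n.+1.
Proof.
have [L rk] := rG k; have [L' rk1] := rG k.+1; exists L' => n.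
have a1 := @regular_adapted _ _ _ rk1 n.+1; have a2 := @regular_adapted_next _ _ _ rk1 n.
have m1 := adapted_measurable hm a1; have m2 := adapted_measurable hm a2.
set M1 := _ * M in rk1.
have i1 : P.-integrable setT (EFin \o (fun w => G k.+1 (th n.+1 w) (Xn n.+1 w))).
  by apply: (integrable_bounded P (M := M1)) => // w; exact: (regular_bounded rk1).
have i2 : P.-integrable setT (EFin \o (fun w => G k.+1 (th n w) (Xn n.+1 w))).
  by apply: (integrable_bounded P (M := M1)) => // w; exact: (regular_bounded rk1).
have i3 : P.-integrable setT (EFin \o (fun w => pi_op (th n.+1 w) f)).
  by apply: (integrable_bounded P (M := M)) => //; exact: (adapted_measurable hm (@mpn n.+1)).
have i4 := integrableZl measurableT (rho * (1 - rho) ^+ k) i3.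
have eE : e k n.+1 = \int[P]_w G k.+1 (th n.+1 w) (Xn n.+1 w)
    + rho * (1 - rho) ^+ k * pn n.+1.
  rewrite /pn -RintegralZl// -RintegralD//.
  have b1 : exists B : R, forall w : Omega, `|1 : R| <= B by exists `|1|.
  have := @tower_regular _ _ _ rk n.+1 (fun=> 1) (measurable_cst _) b1.
  under eq_Rintegral do rewrite mul1r.
  under [in RHS]eq_Rintegral do rewrite mul1r.
  rewrite -/(e k n.+1) => ->; apply: eq_Rintegral => w _.
  by rewrite [G k.+1 _]/= /residual_operator pi_G// mulrA subrK.
have -> : e k n.+1 - e k.+1 n - rho * (1 - rho) ^+ k * pn n.+1 =
    \int[P]_w G k.+1 (th n.+1 w) (Xn n.+1 w) - e k.+1 n by rewrite eE; ring.
rewrite -RintegralB//.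
rewrite (le_trans (ler_norm_Rintegral (g := fun=> L' * gam n.+1) _ _ _))//.
- exact: measurable_funB.
- exact: finite_measure_integrable_cst.
- move=> w; rewrite distrC; exact: (regular_close rk1).
rewrite Rintegral_cst// (_ : fine _ = 1) ?mulr1//.
exact: (congr1 fine (@probability_setT _ _ _ P)).
Qed.

Let e_bound k n : `|e k n - (1 - rho) ^+ k * pi_op ts f| <= 2 * M * (1 - rho) ^+ k.
Proof.
have [L rk] := rG k; have r0 : 0 <= (1 - rho) ^+ k by rewrite exprn_ge0// subr_ge0.
have a2 := adapted_measurable hm (@regular_adapted_next _ _ _ rk n).
have h : `|e k n| <= (1 - rho) ^+ k * M.
  rewrite (le_trans (ler_norm_Rintegral (g := fun=> (1 - rho) ^+ k * M) _ _ _))//.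
  - exact: finite_measure_integrable_cst.
  - by move=> w; exact: (regular_bounded rk).
  rewrite Rintegral_cst// (_ : fine _ = 1) ?mulr1//.
  exact: (congr1 fine (@probability_setT _ _ _ P)).
rewrite (le_trans (ler_normB _ _))// normrM (ger0_norm r0).
have := ler_wpM2l r0 (normr_pi_op H mf fM theta_star_Theta).
by move: h; lra.
Qed.

(** Each unfolding of [e_step] raises k by one and uses up one unit of j, so k must be general. The
    three errors eps / 3 come from [e_step], the induction hypothesis and the convergence of
    [pn]. *)
Let e_limsup j k eps : 0 < eps ->
  \forall n \near \oo, `|e k n - (1 - rho) ^+ k * pi_op ts f|
    <= 2 * M * (1 - rho) ^+ (k + j) + eps.
Proof.
elim: j k eps => [|j IH] k eps eps0.
  by apply: nearW => n; rewrite addn0 (le_trans (e_bound k n))// lerDl ltW.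
have [L hL] := e_step k.
have e3 : 0 < eps / 3 by rewrite divr_gt0.
have [N1 _ h1] := IH k.+1 _ e3.
have c2 : (fun n => L * gam n.+1) @ \oo --> 0.
  by rewrite -(mulr0 L); apply: cvgMl_tmp.
have [N2 _ h2] := cvgr_lt _ c2 _ e3.
have [N3 _ h3] : \forall n \near \oo, `|pi_op ts f - pn n| <= eps / 3.
  by have /cvgrPdist_le/(_ _ e3) := pn_cvg.
exists (maxn N1 (maxn N2 N3)).+1 => // -[//|n] /=.
rewrite ltnS !geq_max => /andP[/h1/= {}h1 /andP[/h2/= {}h2 /leqW/h3/= {}h3]].
have r0 : 0 <= 1 - rho by rewrite subr_ge0.
have r1 : 1 - rho <= 1 by rewrite gerBl ltW.
have rk0 : 0 <= (1 - rho) ^+ k by rewrite exprn_ge0.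
have rk1 : (1 - rho) ^+ k <= 1 by rewrite exprn_ile1.
rewrite addnS -addSn.
have -> : e k n.+1 - (1 - rho) ^+ k * pi_op ts f =
  (e k n.+1 - e k.+1 n - rho * (1 - rho) ^+ k * pn n.+1) +
  (e k.+1 n - (1 - rho) ^+ k.+1 * pi_op ts f) -
  rho * (1 - rho) ^+ k * (pi_op ts f - pn n.+1) by rewrite exprS; ring.
rewrite (le_trans (ler_normB _ _))//.
have h4 : `|rho * (1 - rho) ^+ k * (pi_op ts f - pn n.+1)| <= eps / 3.
  have w0 : 0 <= rho * (1 - rho) ^+ k by rewrite mulr_ge0// ltW.
  have w1 : rho * (1 - rho) ^+ k <= 1 by rewrite mulr_ile1// ltW.
  by rewrite normrM (ger0_norm w0); apply: le_trans h3; rewrite ler_piMl.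
have := ler_normD (e k n.+1 - e k.+1 n - rho * (1 - rho) ^+ k * pn n.+1)
  (e k.+1 n - (1 - rho) ^+ k.+1 * pi_op ts f).
have := hL n; move: h1 h2 h4; lra.
Qed.

Lemma expectation_cvg :
  (fun n => \int[P]_w f (Xn n w)) @ \oo --> pi_op ts f.
Proof.
rewrite -cvg_shiftS; apply/cvgrPdist_le => eps eps0.
have c : (fun j => 2 * M * (1 - rho) ^+ j) @ \oo --> 0.
  rewrite -(mulr0 (2 * M)); apply: cvgMl_tmp; apply: cvg_expr.
  by rewrite ger0_norm ?subr_ge0// gtrBl.
have e2 : 0 < eps / 2 by rewrite divr_gt0.
have [j _ hj] := cvgr_lt _ c _ e2.
have [N _ hN] := @e_limsup j 0%N _ e2.
exists N => // n Nn /=; rewrite distrC.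
have := hN n Nn; rewrite expr0 mul1r add0n.
by have := hj j (leqnn j); rewrite /= => ? /le_trans; apply; lra.
Qed.

End bounded_test_function.

End convergence.

(** * From the extended-real sums of (A3) to real series, and finiteness of lambda *)

Section series_of_extended_reals.
Context {R : realType}.

Let partial_sum (u : nat -> R) n :
  (\sum_(1 <= k < n.+1) (u k)%:E)%E = (series (fun k => u k.+1) n)%:E.
Proof. by rewrite sumEFin big_add1/=. Qed.

Lemma eseries_pinfty_dvg (u : nat -> R) :
  (\sum_(1 <= k <oo) (u k)%:E = +oo)%E -> ~ cvgn (series (fun k => u k.+1)).
Proof.
move=> uoo cu.
have : (fun n => \sum_(1 <= k < n) (u k)%:E)%E @ \oo -->
    (limn (series (fun k => u k.+1)))%:E.
  rewrite -cvg_shiftS/=; under eq_cvg do rewrite partial_sum.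
  by apply: cvg_EFin => //; exact: nearW.
by move/cvg_lim => h; rewrite h in uoo.
Qed.

Lemma nneseries_lty_cvg (u : nat -> R) : (forall k, 0 <= u k.+1) ->
  (\sum_(1 <= k <oo) (u k)%:E < +oo)%E -> cvgn (series (fun k => u k.+1)).
Proof.
move=> u0 uoo.
have u0' k : (1 <= k)%N -> true -> (0 <= (u k)%:E)%E.
  by case: k => // k _ _; rewrite lee_fin.
apply: (@cvg_series_bounded_ge0 _ _ (fine (\sum_(1 <= k <oo) (u k)%:E)%E)) => // n.
rewrite -lee_fin fineK; last by rewrite ge0_fin_numE// nneseries_ge0.
by rewrite -partial_sum; exact: nneseries_lim_ge.
Qed.

End series_of_extended_reals.

(** Equality of bundled measures allows [lam] to be replaced everywhere by a [finite_measure], the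
    structure used in the preceding sections. *)
Lemma finite_measure_of_lty {R : realType} d (T : measurableType d)
    (mu : {measure set T -> \bar R}) : (mu setT < +oo)%E ->
  exists nu : {finite_measure set T -> \bar R}, mu = nu.
Proof.
move=> muoo; exists (mfrestr measurableT muoo); apply: eq_measure.
by apply/funext => A; rewrite /= /mfrestr /mrestr setIT.
Qed.

Theorem theorem3
  (R : realType) (d : nat) (dX : measure_display) (X : measurableType dX)
  (lam : {measure set X -> \bar R}) (pi : X -> R) (I : X -> 'I_d)
  (q : X -> X -> R) (gam : nat -> R)
  (dO : measure_display) (Omega : measurableType dO) (P : probability Omega R)
  (Xn : nat -> Omega -> X) (th : nat -> Omega -> 'I_d -> R) :
  (* setting *)
  @polish_borel R _ X ->
  sigma_finite setT lam ->
  (2 <= d)%N ->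
  (forall i, measurable (part I i)) ->
  measurable_fun setT pi -> (forall x, 0 <= pi x) ->
  (\int[lam]_x (pi x)%:E = 1)%E ->
  (* (A1) *)
  (exists c C : R, 0 < c /\ forall x, c <= pi x <= C) ->
  (forall i, 0 < theta_star lam pi I i) ->
  (* (A2): symmetric proposal density bounded below *)
  measurable_fun setT (fun xy : X * X => q xy.1 xy.2) ->
  (forall x y, q x y = q y x) ->
  (forall x, (\int[lam]_y (q x y)%:E = 1)%E) ->
  (exists c : R, 0 < c /\ forall x y, c <= q x y) ->
  (* (A3) *)
  (forall n, 0 <= gam n.+1 < 1) ->
  (forall n, gam n.+2 <= gam n.+1) ->
  (fun n => gam n) @ \oo --> 0 ->
  (\sum_(1 <= n <oo) (gam n)%:E = +oo)%E ->
  (\sum_(1 <= n <oo) (gam n ^+ 2)%:E < +oo)%E ->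
  (* the algorithm *)
  measurable_fun setT (Xn 0) ->
  (forall i, measurable_fun setT (fun w => th 0 w i)) ->
  (forall w, in_Theta (th 0 w)) ->
  (forall n, measurable_fun setT (Xn n)) ->
  (forall n w, th n.+1 w = fun i => th n w i + gam n.+1 * H_wl I (Xn n.+1 w) (th n w) i) ->
  (forall n (A : set X) (B : set Omega), measurable A ->
     <<s [set C | exists i, exists2 U : set R, measurable U & C = (fun w => th 0 w i) @^-1` U]
         `|` [set C | exists k, exists2 U : set X, (k <= n)%N /\ measurable U & C = Xn k @^-1` U] >> B ->
     P (B `&` (Xn n.+1 @^-1` A)) = (\int[P]_(w in B) mh_kernel lam pi I q (th n w) (Xn n w) A)%E) ->
  (* conclusion *)
  forall f : X -> R, measurable_fun setT f -> (exists M : R, forall x, `|f x| <= M) ->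
    ((fun n => \int[P]_w (f (Xn n w))%:E) @ \oo -->
       \int[lam]_x (f x * pi_theta lam pi I (theta_star lam pi I) x)%:E)%E
    /\ {ae P, forall w,
         (fun n => ((n%:R)^-1 * \sum_(1 <= k < n.+1) f (Xn k w))%:E) @ \oo -->
           (\int[lam]_x (f x * pi_theta lam pi I (theta_star lam pi I) x)%:E)%E}.
Proof.
move=> _ _ d2 mI mpi pi0 pi1 [c [C [c0 cC]]] tspos mq qsym q1 [cq [cq0 cqq]].
move=> gam01 gamS gamc gams gams2 mX0 mth0 th0T mX thS trans f mf [M fM].
have lamoo : (lam setT < +oo)%E.
  (* Integrating c <= pi against [lam] bounds its total mass. *)
  have h : (c%:E * lam setT <= 1)%E.
    rewrite -pi1 -integral_cst//; apply: ge0_le_integral => //.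
    - by move=> x _; rewrite lee_fin ltW.
    - exact/measurable_EFinP.
    - by move=> x _; rewrite lee_fin; have /andP[] := cC x.
  rewrite ltey; apply/eqP => loo; move: h.
  by rewrite loo gt0_muley ?lte_fin.
have [nu lamE] := finite_measure_of_lty lamoo.
subst lam.
have [m m0 tsm] : exists2 m, 0 < m & forall i, m <= theta_star nu pi I i.
  have [i _ hi] := arg_minP (P := xpredT) (i0 := I point) (theta_star nu pi I) isT.
  by exists (theta_star nu pi I i) => // j; exact: hi.
have HH : wl_setting nu pi I q C m cq.
  split=> // x; have /andP[h1 h2] := cC x.
  by rewrite (lt_le_trans c0 h1).
have g11 : gam 1 < 1 by have /andP[] := gam01 0%N.
(* By monotonicity the first step gamma_1 < 1 serves as the uniform bound [g1]. *)
have gam01' n : 0 <= gam n.+1 <= gam 1.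
  have /andP[-> _] /= := gam01 n.
  by elim: n => // n; exact: le_trans.
have gsum := eseries_pinfty_dvg gams.
have gsqr : cvgn (series (fun k => gam k.+1 ^+ 2)).
  by apply: (@nneseries_lty_cvg _ (fun k => gam k ^+ 2)) => // k; exact: sqr_ge0.
have mean := expectation_cvg HH d2 gam01' g11 gamc gamS gsum gsqr mX mth0 th0T thS
  trans mf fM.
have lln := law_of_large_numbers HH d2 gam01' g11 gamc gamS gsum gsqr mX mth0 th0T thS
  trans mf fM.
have target : (\int[nu]_x (f x * pi_theta nu pi I (theta_star nu pi I) x)%:E)%E =
    (pi_operator nu pi I (theta_star nu pi I) f)%:E.
  rewrite /pi_operator /Rintegral fineK; last first.
    apply: integrable_fin_num => //.
    exact: (integrable_pi_theta_mul HH mf fM (theta_star_Theta HH d2)).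
  by apply: eq_integral => x _; rewrite mulrC.
rewrite target; split.
  rewrite (_ : (fun n => _) = (fun n => (\int[P]_w f (Xn n w))%:E)).
    by apply: cvg_EFin => //; exact: nearW.
  apply/funext => n; rewrite /Rintegral fineK//; apply: integrable_fin_num => //.
  by apply: (integrable_bounded P (M := M)) => //; exact: (measurableT_comp mf).
apply: filterS lln => w lln.
rewrite (_ : (fun n => _) = (fun n => (n%:R^-1 * \sum_(k < n) f (Xn k.+1 w))%:E)).
  by apply: cvg_EFin => //; exact: nearW.
by apply/funext => n; rewrite big_add1 big_mkord.
Qed.
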